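(* In the limit $s\to\infty$ the optimal lower bound on the entropic uncertainty region of $L_1$ and $L_2$ is given by the Maassen–Uffink inequality, which converges to $H(L_1,\rho)+H(L_2,\rho)\ge\frac12$. Precisely: for $s\in\{\tfrac12,1,\tfrac32,\dots\}$ let $B(s)=-\log_{2s+1}(c_s^2)$ be the Maassen–Uffink constant, so that $H(L_1,\rho)+H(L_2,\rho)\ge B(s)$ for all density operators $\rho$ in the spin-$s$ representation. Then $$\lim_{s\to\infty}B(s)=\tfrac12,$$ and this limiting bound is saturated at every point of its boundary curve: for every $(x,y)\in\mathbb R^2$ with $x,y\ge0$ and $x+y=\frac12$ there is a family of states $\rho_s$, with $\rho_s$ in the spin-$s$ representation, such that $$\lim_{s\to\infty}\bigl(H(L_1,\rho_s),H(L_2,\rho_s)\bigr)=(x,y).$$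
   Context: The spin-$s$ representation is the irreducible $(2s+1)$-dimensional representation of $SU(2)$ on $\mathbb C^{2s+1}$, with angular momentum operators $L_1,L_2,L_3$ ($\hbar=1$, $[L_1,L_2]=iL_3$ and cyclic); each $L_j$ has the nondegenerate eigenvalues $-s,-s+1,\dots,s$. For a self-adjoint operator $A$ on $\mathbb C^d$ with nondegenerate spectrum and eigenprojections $P_1,\dots,P_d$, and a density operator $\rho$, the output entropy is the normalized Shannon entropy $H(A,\rho)=-\sum_{i=1}^d\pi_i\log_d\pi_i$ with $\pi_i=\operatorname{tr}(\rho P_i)$ (here $d=2s+1$, $0\log 0=0$). The Maassen–Uffink inequality (known) states $H(A,\rho)+H(B,\rho)\ge-2\log_d c$, where $c=\max_{i,j}|U_{ij}|$ is the maximal modulus of the overlaps between normalized eigenvectors of $A$ and $B$. For $A=L_1$, $B=L_2$ in the spin-$s$ representation this maximal overlap $c_s$ is known to be given by $c_s^2=2^{-2s}\binom{2s}{[s+1/2]}$, where $[\cdot]$ denotes the integer part. *)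

(* Defs.v *)
From mathcomp Require Import all_boot all_order all_algebra.
From mathcomp Require Import complex.
From mathcomp Require Import all_classical all_reals all_analysis.
Import Order.TTheory GRing.Theory Num.Theory.
Import numFieldNormedType.Exports.

Set Implicit Arguments.
Unset Strict Implicit.
Unset Printing Implicit Defensive.

Local Open Scope ring_scope.
Local Open Scope sesquilinear_scope.

(* Operators on C^d are d x d matrices over R[i] acting on column vectors. *)

Definition commutator (R : realType) d (A B : 'M[R[i]]_d) : 'M[R[i]]_d :=
  A *m B - B *m A.

(* MathComp subspaces are row spaces: the rows of W, transposed, span the
   subspace of columns, and invariance under v |-> L v reads W L^T <= W. *)
Definition irreducible_triple (R : realType) d (L1 L2 L3 : 'M[R[i]]_d) : Prop :=
  (0 < d)%N /\
  forall W : 'M[R[i]]_d,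
    stablemx W L1^T -> stablemx W L2^T -> stablemx W L3^T ->
    \rank W = 0%N \/ \rank W = d.

(* The spin s representation, s = (d - 1)/2, is specified up to unitary
   equivalence as the d-dimensional irreducible representation of SU(2) by
   unitaries, given through its angular momentum operators. *)
Definition spin_rep (R : realType) d (L1 L2 L3 : 'M[R[i]]_d) : Prop :=
  [/\ L1 \is hermsymmx, L2 \is hermsymmx & L3 \is hermsymmx] /\
  [/\ commutator L1 L2 = 'i%C *: L3,
      commutator L2 L3 = 'i%C *: L1,
      commutator L3 L1 = 'i%C *: L2 &
      irreducible_triple L1 L2 L3].

Definition density (R : realType) d (rho : 'M[R[i]]_d) : Prop :=
  [/\ rho \is hermsymmx,
      forall v : 'cV[R[i]]_d, 0 <= (v^t* *m rho *m v) 0 0 &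
      \tr rho = 1].

(* For self-adjoint A, A = (spectralmx A)^t* D (spectralmx A) with D diagonal
   and spectralmx A unitary, so the adjoints of the rows of spectralmx A are an
   orthonormal basis of eigenvectors.  If the spectrum of A is nondegenerate
   they are unique up to phase and order; then eigenproj enumerates the
   eigenprojections, and entropy and max_overlap depend on no choice. *)
Definition eigenvec (R : realType) d (A : 'M[R[i]]_d) (i : 'I_d) : 'cV[R[i]]_d :=
  (row i (spectralmx A))^t*.

Definition eigenproj (R : realType) d (A : 'M[R[i]]_d) (i : 'I_d) : 'M[R[i]]_d :=
  eigenvec A i *m (eigenvec A i)^t*.

Definition outcome_prob (R : realType) d (A rho : 'M[R[i]]_d) (i : 'I_d) : R :=
  complex.Re (\tr (rho *m eigenproj A i)).

Definition log_base (R : realType) (d : nat) (x : R) : R := ln x / ln d%:R.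

(* The convention 0 log 0 = 0 is automatic. *)
Definition entropy (R : realType) d (A rho : 'M[R[i]]_d) : R :=
  - \sum_(i < d) outcome_prob A rho i * log_base d (outcome_prob A rho i).

Definition overlap (R : realType) d (A B : 'M[R[i]]_d) (i j : 'I_d) : R[i] :=
  ((eigenvec A i)^t* *m eigenvec B j) 0 0.

Definition max_overlap (R : realType) d (A B : 'M[R[i]]_d) : R :=
  \big[Num.max/0]_(i < d) \big[Num.max/0]_(j < d)
    ComplexField.Normc.normc (overlap A B i j).

Definition maassen_uffink (R : realType) d (A B : 'M[R[i]]_d) : R :=
  - log_base d (max_overlap A B ^+ 2).

(* Main.v *)
(* Maassen-Uffink: with P = diag (sqrt pi) and Q = diag (sqrt q) built from the two
   outcome laws, the operator norm of P^t U Q^t is at most c^t for t = 2^-m, by halving t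
   through an eigenvector of T T^*; all states are fixed at t = 0, so comparing slopes at 0
   gives the entropies.

   The overlaps of L1 and L2 are the coefficients of (1 + X)^(n - k) (1 - X)^k, up to
   normalization.  Extracting a coefficient by averaging over a circle of the saddle-point
   radius, comparing binomial weights by a Hellinger-type inequality, Stirling bounds and
   the spacing of cosines show that the squared overlaps are O(n^(-1/2)), uniformly.  Hence
   B(s) >= 1/2 - O(1 / ln n).

   The point (x, y) is reached by 2 y |e><e| + 2 x |f><f|, where e and f are the top
   eigenvectors of L1 and L2.  Each outcome law is a point mass mixed with a binomial law
   of variance n / 4, whose entropy is at most (1 / 2) ln n + O(1); the O(1) terms vanish
   after division by ln (n + 1).  Together with Maassen-Uffink this squeezes both entropies
   and B(s) itself. *)
Require Import Defs.
From mathcomp Require Import all_boot all_order all_algebra.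
From mathcomp Require Import complex.
From mathcomp Require Import all_classical all_reals all_analysis.
From mathcomp Require Import ring lra zify.
Import Order.TTheory GRing.Theory Num.Theory.
Import numFieldNormedType.Exports.

Set Implicit Arguments.
Unset Strict Implicit.
Unset Printing Implicit Defensive.

Local Open Scope classical_set_scope.
Local Open Scope ring_scope.

(** * The Maassen-Uffink inequality *)

(** Logarithms are taken to base n + 1, so a constant factor in an overlap or a constant term in an
    entropy costs only O(1 / ln n): orders of magnitude are enough throughout. The upper estimate of
    B(s) comes from testing Maassen-Uffink itself on an eigenvector of L1. The obstacle is
    uniformity of the overlap bound. At the ends of the half circle the cosine is stationary, and
    the circle average may be as large as M^(-1/4), with M = j (n - j) / (2 n), instead of M^(-1/2).
    Squared, this is of order (n / (j (n - j)))^(1/2), which is also the order of the binomial mass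
    at j standing on the other side of the inequality, so the loss cancels. What remains is the
    binomial mass at k, of order n^(-1/2) only when k stays away from 0 and n. The overlaps are
    symmetric in j and k, so k may be taken as the more central index; if even k is near an end, so
    is j, and the average is exponentially small. *)

Section HermitianSpace.
Local Open Scope sesquilinear_scope.
Variable C : numClosedFieldType.
Local Notation "''[' u , v ]" := (dotmx u v) : ring_scope.
Local Notation "''[' u ]" := '[u, u]%R : ring_scope.

Lemma trmxC_mul m n p (A : 'M[C]_(m, n)) (B : 'M[C]_(n, p)) :
  (A *m B)^t* = B^t* *m A^t*.
Proof. by rewrite trmx_mul map_mxM. Qed.

Lemma dotmx_ge0 n (u : 'rV[C]_n) : 0 <= '[u].
Proof.
rewrite dotmxE mxE; apply: sumr_ge0 => i _.
by rewrite !mxE mul_conjC_ge0.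
Qed.

Lemma dotmx_eq0 n (u : 'rV[C]_n) : '[u] = 0 -> u = 0.
Proof.
move=> u0; apply/eqP/negP => /negP /(@dotmx_is_dotmx C n u).
by rewrite u0 ltxx.
Qed.

Lemma dotmx_sum n (u : 'rV[C]_n) : '[u] = \sum_i `|u 0 i| ^+ 2.
Proof. by rewrite dotmxE mxE; apply: eq_bigr => i _; rewrite !mxE normCK. Qed.

Lemma dotmxZ n (a : C) (u : 'rV[C]_n) : '[a *: u] = `|a| ^+ 2 * '[u].
Proof.
rewrite !dotmx_sum mulr_sumr; apply: eq_bigr => i _.
by rewrite mxE normrM exprMn.
Qed.

Lemma dotmxMl n (u v : 'rV[C]_n) (A : 'M[C]_n) : '[u *m A, v] = '[u, v *m A^t*].
Proof. by rewrite !dotmxE trmxC_mul trmxCK mulmxA. Qed.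

Lemma dotmx_unitary n (u : 'rV[C]_n) (U : 'M[C]_n) :
  U \is unitarymx -> '[u *m U] = '[u].
Proof. by move=> Uu; rewrite dotmxMl mulmxtVK. Qed.

Lemma row_unitary n (U : 'M[C]_n) i : U \is unitarymx -> '[row i U] = 1.
Proof. by move=> /row_unitarymxP ->; rewrite eqxx. Qed.

Lemma hermsymmxP n (A : 'M[C]_n) : A \is hermsymmx -> A^t* = A.
Proof. by move=> /is_hermitianmxP; rewrite expr0 scale1r => <-. Qed.

Lemma hermsymmx_intro n (A : 'M[C]_n) : A^t* = A -> A \is hermsymmx.
Proof. by move=> h; apply/is_hermitianmxP; rewrite expr0 scale1r h. Qed.

Lemma spectral_row n (A : 'M[C]_n) i : A \is hermsymmx ->
  row i (spectralmx A) *m A = spectral_diag A 0 i *: row i (spectralmx A).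
Proof.
move=> Ah; have /orthomx_spectralP {2}-> := hermitian_normalmx Ah.
rewrite !mulmxA -!row_mul mulmxV ?spectral_unit // mul1mx.
by apply/rowP => j; rewrite mul_diag_mx !mxE.
Qed.

(* If s is a unit eigenvector of (P U Q)(P U Q)^* for the eigenvalue e, then
   s P U is dilated by the factor e under Q^2 U^* P^2, whence e <= k. *)
Lemma contraction_sqrt n (P U Q : 'M[C]_n) (k : C) :
    P^t* = P -> Q^t* = Q -> U \is unitarymx -> 0 <= k ->
    (forall x : 'rV_n, '[x *m (Q *m Q *m U^t* *m (P *m P))] <= k ^+ 2 * '[x]) ->
  forall x : 'rV_n, '[x *m (P *m U *m Q)] <= k * '[x].
Proof.
move=> Ph Qh Uu k0 kP x; set M := P *m U *m Q.
have Gh : M *m M^t* \is hermsymmx.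
  by apply: hermsymmx_intro; rewrite trmxC_mul trmxCK.
set G := M *m M^t* in Gh; set S := spectralmx G.
have Su : S \is unitarymx := spectral_unitarymx G.
have dM (y : 'rV_n) : '[y *m M] = '[y *m G, y].
  by rewrite [LHS]dotmxMl [RHS]dotmxMl (hermsymmxP Gh) /G mulmxA.
have eig_ge0 i : 0 <= spectral_diag G 0 i.
  have := dotmx_ge0 (row i S *m M); rewrite dM spectral_row //.
  by rewrite dotmxE -scalemxAl mxE -dotmxE row_unitary ?mulr1.
have eig_le i : spectral_diag G 0 i <= k.
  set e := spectral_diag G 0 i; set w := row i S *m P.
  have eE : e *: row i S = row i S *m G by rewrite spectral_row.
  have wE : (w *m U) *m (Q *m Q *m U^t* *m (P *m P)) = e *: w.
    rewrite /w !mulmxA scalemxAl eE /G /M.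
    by rewrite !trmxC_mul Ph Qh !mulmxA.
  have := kP (w *m U); rewrite wE dotmxZ dotmx_unitary //.
  (* If s P = 0, then s is annihilated by the whole product, so the eigenvalue is 0; otherwise '[w]
     can be cancelled. *)
  have [w0 _|w_neq0] := eqVneq '[w] 0.
    have w0' := dotmx_eq0 w0.
    have : e *: row i S = 0.
      rewrite eE /G /M !trmxC_mul Ph Qh !mulmxA.
      by rewrite -/w w0' !mul0mx.
    move=> /(congr1 (fun v => '[v])).
    rewrite dotmxZ row_unitary // mulr1 dotmxE mul0mx mxE => /eqP.
    by rewrite sqrf_eq0 normr_eq0 => /eqP ->.
  rewrite ler_pM2r ?lt_def ?w_neq0 ?dotmx_ge0 // ger0_norm ?eig_ge0 //.
  by rewrite ler_sqr ?nnegrE ?eig_ge0.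
have -> : '[x *m M] = \sum_i spectral_diag G 0 i * `|(x *m S^t*) 0 i| ^+ 2.
  rewrite dM; have /orthomx_spectralP {1}-> := hermitian_normalmx Gh.
  rewrite invmx_unitary // -/S !mulmxA dotmxMl dotmxE mxE.
  apply: eq_bigr => i _; rewrite mul_mx_diag !mxE normCK.
  by rewrite (mulrC _ (spectral_diag G 0 i)) mulrA.
rewrite -(@dotmx_unitary _ x (S^t*)) ?trmxC_unitary // dotmx_sum mulr_sumr.
by apply: ler_sum => i _; rewrite ler_wpM2r ?exprn_ge0.
Qed.

Lemma dotmx_CauchySchwarz n (u v : 'rV[C]_n) : `|'[u, v]| ^+ 2 <= '[u] * '[v].
Proof. by have [] := CauchySchwarz (@dotmx C n) u v. Qed.

(** Cauchy-Schwarz, column by column. It settles the time t = 1, where the squared entries p_i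
    |U_ij|^2 q_j of P U Q add up to at most c^2. *)
Lemma dotmx_hilbert_schmidt n (M : 'M[C]_n) (x : 'rV[C]_n) :
  '[x *m M] <= (\sum_i \sum_j `|M i j| ^+ 2) * '[x].
Proof.
rewrite dotmx_sum exchange_big /= mulr_suml; apply: ler_sum => j _.
have -> : (x *m M) 0 j = '[x, (col j M)^t*].
  by rewrite dotmxE trmxCK mxE [RHS]mxE; apply: eq_bigr => i _; rewrite !mxE.
apply: le_trans (dotmx_CauchySchwarz _ _) _.
rewrite mulrC ler_wpM2r ?dotmx_ge0 // dotmx_sum.
by apply: ler_sum => i _; rewrite !mxE norm_conjC.
Qed.

End HermitianSpace.

(** * Slopes at time 0 from dyadic times *)

Section RealLemmas.
Variable R : realType.
Implicit Types x y : R.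

Lemma exp2_unbounded x : exists m : nat, x < 2 ^+ m.
Proof.
exists (Num.bound `|x|); apply: lt_le_trans (_ : (Num.bound `|x|)%:R <= _).
  by apply: le_lt_trans (ler_norm x) _; rewrite archi_boundP.
by rewrite -natrX ler_nat ltnW // ltn_expl.
Qed.

(** From e^(-y) >= 1 - y follows e^y <= 1 / (1 - y), and (1 - y) (1 + y + 2 y^2) = 1 + y^2 (1 - 2 y)
    is at least 1 for y <= 1/2. *)
Lemma expR_taylor1 y : `|y| <= 2^-1 -> `|expR y - 1 - y| <= 2 * y ^+ 2.
Proof.
move=> y12; have y1 := expR_ge1Dx y; have y2 := expR_ge1Dx (- y).
have E : expR y * expR (- y) = 1 by rewrite -expRD subrr expR0.
have /andP[ya yb] : - 2^-1 <= y <= 2^-1 by move: y12; rewrite ler_norml.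
rewrite ger0_norm; last by lra.
have : (1 - y) * expR y <= (1 - y) * (1 + y + 2 * y ^+ 2) by nra.
rewrite ler_pM2l; lra.
Qed.

(* The hypothesis only concerns the times 2^-m; letting m grow yields the
   derivative at time 0. *)
Lemma sum_expR_slope (I : finType) (a b : I -> R) :
    \sum_i a i = 0 -> (forall m : nat, \sum_i a i * expR (b i / 2 ^+ m) <= 0) ->
  \sum_i a i * b i <= 0.
Proof.
move=> a0 abm; rewrite leNgt; apply/negP => S0.
set S := \sum_i a i * b i in S0.
(* [B] dominates every |b_i| and [K] collects the second-order errors. For [m] large, t = 2^-m
   satisfies t B <= 1/2 and K t < S, and a positive slope S would then outweigh the error. *)
pose B := 1 + \sum_i `|b i|; pose K := \sum_i `|a i| * (2 * b i ^+ 2).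
have B1 : 1 <= B by rewrite lerDl sumr_ge0.
have K0 : 0 <= K.
  by apply: sumr_ge0 => i _; rewrite mulr_ge0 // mulr_ge0 // sqr_ge0.
have [m mP] := exp2_unbounded (2 * B + K / S).
have KS : 0 <= K / S by rewrite divr_ge0 // ltW.
have t0 : 0 < (2 ^+ m : R)^-1 by rewrite invr_gt0.
set t := (2 ^+ m)^-1 in t0.
have tB : t * B <= 2^-1.
  by rewrite /t mulrC ler_pdivrMr //; lra.
have tK : K * t < S.
  rewrite /t ltr_pdivrMr // -ltr_pdivrMl // mulrC; lra.
suff : S * t <= K * t ^+ 2.
  by rewrite expr2 mulrA ler_pM2r // leNgt tK.
have := abm m; rewrite -/t => abt.
suff : S * t - K * t ^+ 2 <= \sum_i a i * expR (b i * t) - \sum_i a i by lra.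
rewrite /S /K !mulr_suml -!sumrB; apply: ler_sum => i _.
have bt : `|b i * t| <= 2^-1.
  rewrite normrM (gtr0_norm t0) mulrC; apply: le_trans tB.
  rewrite ler_pM2l // /B (bigD1 i) //= addrCA lerDl addr_ge0 // sumr_ge0 //.
have := ler_wpM2l (normr_ge0 (a i)) (expR_taylor1 bt).
rewrite -normrM => h; have := ler_norm (- (a i * (expR (b i * t) - 1 - b i * t))).
rewrite normrN; lra.
Qed.

(** The right side becomes one more term, of weight -1 and exponent [c]; [option I] supplies its
    index, and the weights then add up to 0. *)
Lemma sum_expR_slope_le (I : finType) (a b : I -> R) (c : R) :
    \sum_i a i = 1 ->
    (forall m : nat, \sum_i a i * expR (b i / 2 ^+ m) <= expR (c / 2 ^+ m)) ->
  \sum_i a i * b i <= c.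
Proof.
move=> a1 abm.
pose a' (o : option I) := if o is Some i then a i else - 1.
pose b' (o : option I) := if o is Some i then b i else c.
have optE (F : option I -> R) : \sum_o F o = F None + \sum_i F (Some i).
  rewrite (bigD1 None) //=; congr (_ + _).
  rewrite (reindex_omap Some id) /=; first by apply: eq_bigl => i; rewrite eqxx.
  by case.
have := @sum_expR_slope _ a' b'; rewrite !optE /= a1 addNr => h.
suff : -1 * c + \sum_i a i * b i <= 0 by lra.
by apply: h => // m; rewrite optE /=; have := abm m; lra.
Qed.

End RealLemmas.

Section MaassenUffink.
Local Open Scope sesquilinear_scope.
Local Open Scope complex_scope.
Variable R : realType.
Local Notation C := R[i].
Local Notation normc := ComplexField.Normc.normc.
Local Notation "''[' u , v ]" := (dotmx u v) : ring_scope.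
Local Notation "''[' u ]" := '[u, u]%R : ring_scope.

Lemma normcE_norm (z : C) : `|z| = (normc z)%:C.
Proof. by []. Qed.

Lemma normc_ge0 (z : C) : 0 <= normc z.
Proof. by rewrite -ler0c -normcE_norm. Qed.

Lemma normc_real (x : R) : 0 <= x -> normc x%:C = x.
Proof. by move=> x0; apply: complexI; rewrite -normcE_norm ger0_norm ?ler0c. Qed.

Lemma normc_sqr (z : C) : normc z ^+ 2 = complex.Re (z * conjc z).
Proof. by rewrite -sqr_normc normcE_norm -rmorphXn. Qed.

Lemma Re_le_normc (z : C) : complex.Re z <= normc z.
Proof.
by apply: le_trans (ler_norm _) _; rewrite -lecR -normcE_norm normc_ge_Re.
Qed.


Lemma mulr_regroup (K : comPzRingType) (x w u v y : K) :
  x * (w * u * v) * y = (w * v) * (x * u * y).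
Proof. ring. Qed.

Lemma Re_realM (x : R) (z : C) : complex.Re (x%:C * z) = x * complex.Re z.
Proof. by case: z => a b /=; rewrite mul0r subr0. Qed.

(** The matrix P^t at t = 2^-m. Since P has the entries sqrt(p_i), the exponent of p_i is 2^-(m+1).
    A zero probability gives a zero entry, because [powR] sends 0 to 0 at a positive exponent. *)
Definition dyadic_power d (p : 'I_d -> R) m : 'M[C]_d :=
  diag_mx (\row_i (p i `^ (2 ^+ m.+1)^-1)%:C).

Lemma dyadic_power_herm d (p : 'I_d -> R) m :
  (dyadic_power p m)^t* = dyadic_power p m.
Proof.
rewrite tr_diag_mx map_diag_mx; congr diag_mx; apply/rowP => i.
by rewrite !mxE; exact: conjc_real.
Qed.

Lemma powR_half (x : R) m :
  x `^ (2 ^+ m.+1)^-1 * x `^ (2 ^+ m.+1)^-1 = x `^ (2 ^+ m)^-1.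
Proof.
rewrite -powRD; last by apply/implyP => /eqP h; have : 0 < (2 ^+ m.+1)^-1 + (2 ^+ m.+1)^-1 :> R; [rewrite addr_gt0 ?invr_gt0 ?exprn_gt0|rewrite h ltxx].
by congr (_ `^ _); rewrite exprS; field; rewrite lt0r_neq0.
Qed.

Lemma dyadic_power_sqr d (p : 'I_d -> R) m :
  dyadic_power p m.+1 *m dyadic_power p m.+1 = dyadic_power p m.
Proof.
rewrite mulmx_diag; congr diag_mx; apply/rowP => i; rewrite !mxE -rmorphM.
by rewrite powR_half.
Qed.

(** Halving t through [contraction_sqrt] asks for the bound at the old t on Q^2 times the adjoint of
    U times P^2. The induction hypothesis is therefore applied to the adjoint of [U] with [p] and
    [q] exchanged, which is why all three are generalized. *)
Lemma dyadic_power_contraction m d (U : 'M[C]_d) (p q : 'I_d -> R) (c : R) :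
    U \is unitarymx -> 0 < c -> (forall i j, normc (U i j) <= c) ->
    (forall i, 0 <= p i) -> (forall i, 0 <= q i) ->
    \sum_i p i = 1 -> \sum_i q i = 1 ->
  forall x : 'rV_d, '[x *m (dyadic_power p m *m U *m dyadic_power q m)]
                    <= ((c `^ (2 ^+ m)^-1)%:C) ^+ 2 * '[x].
Proof.
elim: m U p q => [|m IH] U p q Uu c0 Uc p0 q0 p1 q1 x.
  apply: le_trans (dotmx_hilbert_schmidt _ _) _.
  rewrite ler_wpM2r ?dotmx_ge0 // expr0 invr1 (powRr1 (ltW c0)) -rmorphXn.
  have -> : c ^+ 2 = \sum_i \sum_j p i * q j * c ^+ 2.
    transitivity ((\sum_i p i) * (\sum_j q j) * c ^+ 2).
      by rewrite p1 q1 !mul1r.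
    rewrite big_distrlr /= mulr_suml; apply: eq_bigr => i _.
    by rewrite mulr_suml.
  rewrite rmorph_sum; apply: ler_sum => i _.
  rewrite rmorph_sum; apply: ler_sum => j _.
  rewrite mul_diag_mx mul_mx_diag !mxE normcE_norm -rmorphXn lecR.
  rewrite !ComplexField.Normc.normcM !normc_real ?powR_ge0 // !exprMn.
  have half (y : R) : 0 <= y -> (y `^ (2 ^+ 1)^-1) ^+ 2 = y.
    by move=> y0; rewrite expr2 powR_half expr0 invr1 powRr1.
  rewrite !half // mulrAC; apply: ler_wpM2l; first exact: mulr_ge0.
  by rewrite ler_sqr ?nnegrE ?normc_ge0 // ltW.
rewrite -rmorphXn expr2 powR_half.
apply: contraction_sqrt => //; rewrite ?dyadic_power_herm ?ler0c ?powR_ge0 //.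
have Uc' i j : normc (U^t* i j) <= c.
  by rewrite !mxE -lecR -normcE_norm norm_conjC normcE_norm lecR.
have Uu' : U^t* \is unitarymx by rewrite trmxC_unitary.
move=> y; rewrite (dyadic_power_sqr q m).
rewrite (dyadic_power_sqr p m).
exact: (IH (U^t*) q p Uu' c0 Uc' q0 p0 q1 p1 y).
Qed.

(** Row [a] of [X] and of [Y] is meant as the a-th eigenvector of the state, with eigenvalue
    [lam a], written in the two eigenbases; [U] passes from one basis to the other. *)
Lemma maassen_uffink_amplitudes d (U X Y : 'M[C]_d) (lam : 'I_d -> R) (c : R)
    (p := fun i => \sum_a lam a * normc (X a i) ^+ 2)
    (q := fun j => \sum_a lam a * normc (Y a j) ^+ 2) :
    Y = X *m U -> U \is unitarymx -> X \is unitarymx ->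
    (forall a, 0 <= lam a) -> \sum_a lam a = 1 ->
    0 < c -> (forall i j, normc (U i j) <= c) ->
  \sum_i p i * ln (p i) + \sum_j q j * ln (q j) <= 2 * ln c.
Proof.
move=> YE Uu Xu lam0 lam1 c0 Uc.
have Yu : Y \is unitarymx by rewrite YE; exact: (mul_unitarymx Xu Uu).
have sum1 (Z : 'M[C]_d) : Z \is unitarymx -> \sum_i \sum_a lam a * normc (Z a i) ^+ 2 = 1.
  move=> Zu; rewrite exchange_big /= -lam1; apply: eq_bigr => a _.
  rewrite -mulr_sumr -[RHS]mulr1; congr (_ * _); apply: complexI.
  rewrite rmorph_sum -[RHS](@row_unitary _ _ Z a) // dotmx_sum.
  by apply: eq_bigr => i _; rewrite mxE normcE_norm rmorphXn.
have nn (Z : 'M[C]_d) i : 0 <= \sum_a lam a * normc (Z a i) ^+ 2.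
  by apply: sumr_ge0 => a _; rewrite mulr_ge0 ?sqr_ge0.
have zero (Z : 'M[C]_d) i a : \sum_a lam a * normc (Z a i) ^+ 2 = 0 ->
    lam a = 0 \/ Z a i = 0.
  move=> /eqP; rewrite psumr_eq0; last by move=> b _; rewrite mulr_ge0 ?sqr_ge0.
  move=> /allP /(_ a (mem_index_enum _)) /=; rewrite mulf_eq0 => /orP[/eqP|]; first by left.
  by rewrite sqrf_eq0 => /eqP /ComplexField.Normc.eq0_normc; right.
(* A signed joint law with marginals [p] and [q]. Weighted by p_i^(t/2) q_j^(t/2) it sums to an
   average of the real parts of <x_a P^t U Q^t, y_a>, hence to at most c^t, with equality at t = 0;
   the slope at 0 sees only the marginals. *)
pose r i j := \sum_a lam a * complex.Re (X a i * U i j * conjc (Y a j)).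
(* At a zero probability the power is 0, whereas [expR] of a multiple of [ln 0 = 0] is 1. The two
   expressions agree after multiplication because [r] vanishes there. *)
have r0 i j : p i = 0 \/ q j = 0 -> r i j = 0.
  move=> pq0; apply: big1 => a _.
  case: pq0 => h; have [->|Z0] := zero _ _ a h; rewrite ?mul0r //.
    by rewrite Z0 !mul0r raddf0 mulr0.
  by rewrite Z0 conjc0 mulr0 raddf0 mulr0.
have rowsum i : \sum_j r i j = p i.
  rewrite exchange_big /=; apply: eq_bigr => a _; rewrite -mulr_sumr -raddf_sum /=.
  congr (_ * _); rewrite normc_sqr; congr complex.Re.
  under eq_bigr do rewrite -mulrA.
  rewrite -mulr_sumr; congr (_ * _).
  rewrite -[in RHS](mulmxtVK X Uu) -YE mxE rmorph_sum; apply: eq_bigr => j _.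
  rewrite rmorphM mulrC; congr (_ * _); rewrite !mxE; exact: esym (conjcK _).
have colsum j : \sum_i r i j = q j.
  rewrite exchange_big /=; apply: eq_bigr => a _; rewrite -mulr_sumr -raddf_sum /=.
  congr (_ * _); rewrite normc_sqr; congr complex.Re.
  by rewrite -mulr_suml; congr (_ * _); rewrite YE mxE.
have powE (x : R) m : 0 < x -> x `^ (2 ^+ m)^-1 = expR (ln x / 2 ^+ m).
  by move=> x0; rewrite /powR gt_eqF // mulrC.
have dyadic m : \sum_(ij : 'I_d * 'I_d) r ij.1 ij.2 *
    expR ((ln (p ij.1) + ln (q ij.2)) / 2 / 2 ^+ m) <= expR (ln c / 2 ^+ m).
  rewrite -powE //; set k := c `^ _.
  pose P := dyadic_power p m; pose Q := dyadic_power q m.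
  have -> : \sum_(ij : 'I_d * 'I_d) r ij.1 ij.2 *
      expR ((ln (p ij.1) + ln (q ij.2)) / 2 / 2 ^+ m) =
      \sum_a lam a * complex.Re '[row a X *m (P *m U *m Q), row a Y].
    transitivity (\sum_i \sum_j \sum_a lam a *
        complex.Re (X a i * (P *m U *m Q) i j * conjc (Y a j))).
      rewrite pair_big; apply: eq_bigr => -[i j] _ /=.
      transitivity (r i j * (p i `^ (2 ^+ m.+1)^-1 * q j `^ (2 ^+ m.+1)^-1)).
        have [->|rij0] := eqVneq (r i j) 0; first by rewrite !mul0r.
        have [pi0|pi0] := eqVneq (p i) 0; first by rewrite r0 ?eqxx // in rij0; left.
        have [qj0|qj0] := eqVneq (q j) 0; first by rewrite r0 ?eqxx // in rij0; right.
        rewrite !powE ?lt_def ?pi0 ?qj0 ?nn // -expRD; congr (_ * expR _).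
        by rewrite exprS; field; rewrite expf_neq0.
      rewrite mulr_suml; apply: eq_bigr => a _.
      rewrite mul_mx_diag mul_diag_mx !mxE -mulrA; congr (_ * _).
      by rewrite mulr_regroup -rmorphM Re_realM mulrC.
    rewrite exchange_big /=; under eq_bigr do rewrite exchange_big /=.
    rewrite exchange_big /=; apply: eq_bigr => a _.
    under eq_bigr do rewrite -mulr_sumr -raddf_sum /=.
    rewrite -mulr_sumr -raddf_sum /=; congr (_ * complex.Re _).
    rewrite dotmxE -row_mul mxE; apply: eq_bigr => j _; rewrite !mxE.
    by rewrite mulr_suml.
  rewrite -[leRHS]mul1r -lam1 mulr_suml; apply: ler_sum => a _.
  rewrite ler_wpM2l //; apply: le_trans (Re_le_normc _) _.
  rewrite -(@ler_pXn2r _ 2) ?nnegrE ?normc_ge0 ?powR_ge0 //.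
  have := dotmx_CauchySchwarz (row a X *m (P *m U *m Q)) (row a Y).
  rewrite (row_unitary a Yu) mulr1 => h.
  have := le_trans h (dyadic_power_contraction m Uu c0 Uc (nn X) (nn Y)
                        (sum1 _ Xu) (sum1 _ Yu) (row a X)).
  rewrite (row_unitary a Xu) mulr1 normcE_norm -rmorphXn -rmorphXn lecR; apply.
have total : \sum_(ij : 'I_d * 'I_d) r ij.1 ij.2 = 1.
  rewrite -(pair_big xpredT xpredT r) /= -(sum1 X) //.
  by apply: eq_bigr => i _; rewrite rowsum.
have := sum_expR_slope_le total dyadic.
suff -> : \sum_(ij : 'I_d * 'I_d) r ij.1 ij.2 * ((ln (p ij.1) + ln (q ij.2)) / 2) =
   (\sum_i p i * ln (p i) + \sum_j q j * ln (q j)) / 2 by lra.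
rewrite -(pair_big xpredT xpredT (fun i j => r i j * ((ln (p i) + ln (q j)) / 2))) /=.
under eq_bigr do under eq_bigr do rewrite mulrA mulrDr mulrDl.
under eq_bigr do rewrite big_split /=.
rewrite big_split /= mulrDl; congr (_ + _).
  by rewrite mulr_suml; apply: eq_bigr => i _; rewrite -!mulr_suml rowsum.
rewrite exchange_big /=.
by rewrite mulr_suml; apply: eq_bigr => i _; rewrite -!mulr_suml colsum.
Qed.
End MaassenUffink.

(** * Entropies and overlaps in terms of amplitudes *)

Section Entropy.
Local Open Scope sesquilinear_scope.
Local Open Scope complex_scope.
Variable R : realType.
Local Notation C := R[i].
Local Notation normc := ComplexField.Normc.normc.

Lemma outcome_probE d (A rho : 'M[C]_d) i :
  outcome_prob A rho i =
  complex.Re ((spectralmx A *m rho *m (spectralmx A)^t*) i i).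
Proof.
rewrite /outcome_prob /eigenproj /eigenvec trmxCK mulmxA mxtrace_mulC mulmxA.
rewrite -row_mul /mxtrace big_ord1 mxE [in RHS]mxE; congr complex.Re.
by apply: eq_bigr => j _; rewrite !mxE.
Qed.

Lemma overlapE d (A B : 'M[C]_d) i j :
  overlap A B i j = (spectralmx A *m (spectralmx B)^t*) i j.
Proof.
rewrite /overlap /eigenvec trmxCK !mxE; apply: eq_bigr => k _.
by rewrite !mxE.
Qed.

Lemma entropyE d (A rho : 'M[C]_d) :
  entropy A rho =
  - (\sum_i outcome_prob A rho i * ln (outcome_prob A rho i)) / ln d%:R.
Proof.
rewrite /entropy mulNr mulr_suml; congr (- _); apply: eq_bigr => i _.
by rewrite /log_base mulrA.
Qed.

Lemma max_overlap_ub d (A B : 'M[C]_d) i j :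
  normc (overlap A B i j) <= max_overlap A B.
Proof.
apply: le_trans (_ : \big[Num.max/0]_j normc (overlap A B i j) <= _).
  exact: (le_bigmax _ (fun j => normc (overlap A B i j))).
exact: (le_bigmax _ (fun i => \big[Num.max/0]_j normc (overlap A B i j))).
Qed.

Lemma max_overlap_gt0 d (A B : 'M[C]_d.+1) : 0 < max_overlap A B.
Proof.
have Uu : spectralmx A *m (spectralmx B)^t* \is unitarymx.
  apply: mul_unitarymx; rewrite ?trmxC_unitary; exact: spectral_unitarymx.
rewrite ltNge; apply/negP => c0.
have := row_unitary ord0 Uu; rewrite dotmx_sum big1 => [/esym/eqP|j _].
  by rewrite oner_eq0.
rewrite mxE -overlapE normcE_norm.
have := le_trans (max_overlap_ub A B ord0 j) c0.
by rewrite le_eqVlt ltNge normc_ge0 orbF => /eqP ->; rewrite expr0n.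
Qed.

Lemma density_spectrum d (rho : 'M[C]_d) : density rho ->
  exists2 lam : 'I_d -> R, (forall a, 0 <= lam a) /\ \sum_a lam a = 1 &
    rho = (spectralmx rho)^t* *m diag_mx (\row_a (lam a)%:C) *m spectralmx rho.
Proof.
move=> [rhoh rho0 rho1]; set V := spectralmx rho.
have Vu : V \is unitarymx := spectral_unitarymx rho.
have /orthomx_spectralP rhoE := hermitian_normalmx rhoh.
rewrite invmx_unitary // -/V in rhoE.
have D0 a : 0 <= spectral_diag rho 0 a.
  have := rho0 ((row a V)^t*); rewrite trmxCK spectral_row //.
  by rewrite -scalemxAl mxE -dotmxE row_unitary // mulr1.
have lamE a : (complex.Re (spectral_diag rho 0 a))%:C = spectral_diag rho 0 a.
  by rewrite RRe_real // ger0_real.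
exists (fun a => complex.Re (spectral_diag rho 0 a)).
  split=> [a|]; first by rewrite -ler0c lamE.
  apply: complexI; rewrite rmorph_sum -[RHS]rho1 [in RHS]rhoE mxtrace_mulC mulmxA.
  rewrite (unitarymxP _) // mul1mx mxtrace_diag.
  by apply: eq_bigr => a _; exact: lamE.
suff -> : \row_a (complex.Re (spectral_diag rho 0 a))%:C = spectral_diag rho.
  exact: rhoE.
by apply/rowP => a; rewrite mxE lamE.
Qed.

Lemma ler_opp_scaled (a b c l : R) :
  0 < l -> a + b <= 2 * c -> - (c *+ 2 * l) <= - a * l + - b * l.
Proof. by move=> l0 abc; rewrite -mulrDl -mulNr ler_pM2r //; lra. Qed.

Lemma Re_conj_diag d (X : 'M[C]_d) (lam : 'I_d -> R) i :
  complex.Re ((X^t* *m diag_mx (\row_a (lam a)%:C) *m X) i i) =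
  \sum_a lam a * normc (X a i) ^+ 2.
Proof.
rewrite mxE raddf_sum; apply: eq_bigr => a _.
rewrite mul_mx_diag !mxE normc_sqr -Re_realM; congr complex.Re.
by rewrite mulrAC mulrC (mulrC (X a i)).
Qed.

Lemma maassen_uffink_le d (A B rho : 'M[C]_d.+1) : (0 < d)%N -> density rho ->
  maassen_uffink A B <= entropy A rho + entropy B rho.
Proof.
move=> d0 /density_spectrum [lam [lam0 lam1]]; set V := spectralmx rho => rhoE.
pose X (S : 'M[C]_d.+1) := V *m (spectralmx S)^t*.
have Xu S : X S \is unitarymx.
  apply: mul_unitarymx; rewrite ?trmxC_unitary; exact: spectral_unitarymx.
have probE S i : outcome_prob S rho i = \sum_a lam a * normc (X S a i) ^+ 2.
  rewrite outcome_probE rhoE.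
  have -> : spectralmx S *m (V^t* *m diag_mx (\row_a (lam a)%:C) *m V) *m (spectralmx S)^t*
     = (X S)^t* *m diag_mx (\row_a (lam a)%:C) *m X S.
    by rewrite /X trmxC_mul trmxCK !mulmxA.
  exact: Re_conj_diag.
have XU : X B = X A *m (spectralmx A *m (spectralmx B)^t*).
  by rewrite /X mulmxA mulmxKtV ?spectral_unitarymx.
have Uu : spectralmx A *m (spectralmx B)^t* \is unitarymx.
  apply: mul_unitarymx; rewrite ?trmxC_unitary; exact: spectral_unitarymx.
have Uc i j : normc ((spectralmx A *m (spectralmx B)^t*) i j) <= max_overlap A B.
  by rewrite -overlapE max_overlap_ub.
have sumE S : \sum_i (\sum_a lam a * normc (X S a i) ^+ 2) *
    ln (\sum_a lam a * normc (X S a i) ^+ 2) =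
    \sum_i outcome_prob S rho i * ln (outcome_prob S rho i).
  by apply: eq_bigr => i _; rewrite probE.
have h := maassen_uffink_amplitudes XU Uu (Xu A) lam0 lam1
  (max_overlap_gt0 A B) Uc.
have {}h : \sum_i outcome_prob A rho i * ln (outcome_prob A rho i) +
    \sum_i outcome_prob B rho i * ln (outcome_prob B rho i)
    <= 2 * ln (max_overlap A B).
  by apply: le_trans h; apply: lerD; [have := sumE A|have := sumE B] => ->.
have lnd : 0 < (ln d.+1%:R)^-1 :> R by rewrite invr_gt0 ln_gt0 // ltr1n.
rewrite !entropyE /maassen_uffink /log_base lnXn ?max_overlap_gt0 //.
exact: ler_opp_scaled lnd h.
Qed.

End Entropy.

(** * Eigenbases of a spin representation *)

Section HermitianEigen.
Local Open Scope sesquilinear_scope.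
Variable C : numClosedFieldType.
Local Notation "''[' u , v ]" := (dotmx u v) : ring_scope.
Local Notation "''[' u ]" := '[u, u]%R : ring_scope.

Lemma dotmxZl n (a : C) (u v : 'rV[C]_n) : '[a *: u, v] = a * '[u, v].
Proof. by rewrite !dotmxE -scalemxAl mxE. Qed.

Lemma dotmxZr n (a : C) (u v : 'rV[C]_n) : '[u, a *: v] = a^* * '[u, v].
Proof. by rewrite !dotmxE linearZ /= map_mxZ -scalemxAr mxE. Qed.

Lemma herm_eigenvec_ortho n (A : 'M[C]_n) (u v : 'rV[C]_n) (a b : C) :
    A^t* = A -> u *m A = a *: u -> v *m A = b *: v -> b \is Num.real ->
  a != b -> '[u, v] = 0.
Proof.
move=> Ah uA vA br ab; have : '[u *m A, v] = '[u, v *m A^t*] by exact: dotmxMl.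
rewrite Ah uA vA dotmxZl dotmxZr (CrealP br) => /eqP.
by rewrite -subr_eq0 -mulrBl mulf_eq0 subr_eq0 (negPf ab) => /eqP.
Qed.

Lemma herm_eigenval_spectral n (A : 'M[C]_n) (u : 'rV[C]_n) (a : C) :
    A \is hermsymmx -> u *m A = a *: u -> u != 0 ->
  exists i, a = spectral_diag A 0 i.
Proof.
move=> Ah uA u0; have /orthomx_spectralP AE := hermitian_normalmx Ah.
set S := spectralmx A in AE.
have Su : S \is unitarymx := spectral_unitarymx A.
rewrite invmx_unitary // in AE.
pose z := u *m S^t*.
have zD : z *m diag_mx (spectral_diag A) = a *: z.
  rewrite /z scalemxAl -uA [in RHS]AE !mulmxA; apply: esym.
  exact: (mulmxtVK _ Su).
have z0 : z != 0.
  apply: contraNneq u0 => z0; rewrite -(@mulmxKtV _ _ _ _ u S Su erefl).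
  by rewrite -/z z0 mul0mx.
have /rV0Pn[i zi] := z0; exists i; apply: (mulIf zi).
have := congr1 (fun w : 'rV_n => w 0 i) zD.
by rewrite mul_mx_diag !mxE mulrC => <-.
Qed.

End HermitianEigen.

(** * Ladder operators for the first generator *)

Section SpinLadder.
Local Open Scope sesquilinear_scope.
Local Open Scope complex_scope.
Variable R : realType.
Local Notation C := R[i].
Local Notation "''[' u , v ]" := (dotmx u v) : ring_scope.
Local Notation "''[' u ]" := '[u, u]%R : ring_scope.

Lemma sqr_iC : 'i%C * 'i%C = -1 :> C.
Proof. by rewrite -expr2 sqr_i. Qed.

(** The imaginary unit is a variable with square -1, so that [ring] can reduce by that relation. *)
Lemma ladder_commutator (K : comNzRingType) n (A B D : 'M[K]_n) (i : K) :
    i * i = -1 -> A *m B = i *: D + B *m A ->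
  (A + i *: B) *m (A - i *: B) = (A - i *: B) *m (A + i *: B) + 2 *: D.
Proof.
move=> ii AB.
rewrite !(mulmxDl, mulmxDr, mulmxN, mulNmx) -!scalemxAr -!scalemxAl AB.
move: (A *m A) (B *m A) (B *m B) => X Y Z.
apply/matrixP => k l; rewrite !mxE; ring: ii.
Qed.

Section Representation.
Variables (n : nat) (L1 L2 L3 : 'M[C]_n.+1).
Hypothesis spinL : spin_rep L1 L2 L3.

(** Vectors are rows acted on from the right, which exchanges the usual roles: u L1 = m u gives (u
    Lp) L1 = (m - 1) u Lp, so [Lp] lowers and [Lm] raises. *)
Let Lp := L2 + 'i%C *: L3.
Let Lm := L2 - 'i%C *: L3.

Let L1h : L1^t* = L1. Proof. by have [[/hermsymmxP]] := spinL. Qed.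
Let L2h : L2^t* = L2. Proof. by have [[_ /hermsymmxP]] := spinL. Qed.
Let L3h : L3^t* = L3. Proof. by have [[_ _ /hermsymmxP]] := spinL. Qed.

Let Lph : Lp^t* = Lm.
Proof.
rewrite /Lp /Lm linearD linearZ /= map_mxD map_mxZ L2h L3h -scaleNr.
by congr (_ + _ *: _); apply/eqP; rewrite eq_complex /= oppr0 !eqxx.
Qed.

Let commL1p : L1 *m Lp = Lp *m L1 + Lp.
Proof.
have [_ [c12 _ c31 _]] := spinL; move: c12 c31; rewrite /commutator.
move=> /eqP; rewrite subr_eq => /eqP c12 /eqP; rewrite subr_eq => /eqP c31.
rewrite /Lp mulmxDr mulmxDl -scalemxAr -scalemxAl c12 c31 scalerDr scalerA.
by rewrite sqr_iC scaleN1r; apply/matrixP => i j; rewrite !mxE; ring.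
Qed.

Let commL1m : L1 *m Lm = Lm *m L1 - Lm.
Proof.
have : (L1 *m Lp)^t* = (Lp *m L1)^t* + Lp^t*.
  by rewrite commL1p linearD map_mxD.
by rewrite !trmxC_mul Lph L1h => ->; rewrite addrK.
Qed.

Let commpm : Lp *m Lm = Lm *m Lp + 2 *: L1.
Proof.
have [_ [_ c23 _ _]] := spinL; apply: ladder_commutator sqr_iC _.
by move: c23; rewrite /commutator => /eqP; rewrite subr_eq => /eqP.
Qed.

(** An eigenvector for the largest eigenvalue m works: if its image under [Lm] were nonzero, m + 1
    would be an eigenvalue as well. *)
Lemma exists_top_vector : exists (v : 'rV[C]_n.+1) (m : R),
  [/\ '[v] = 1, v *m L1 = m%:C *: v & v *m Lm = 0].
Proof.
have L1hs : L1 \is hermsymmx by have [[]] := spinL.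
pose f i := complex.Re (spectral_diag L1 0 i).
have fE i : spectral_diag L1 0 i = (f i)%:C.
  by rewrite RRe_real //; apply/mxOverP/hermitian_spectral_diag_real.
have [i imax] : exists i, forall j, f j <= f i.
  by exists [arg max_(i > ord0) f i]%O; case: arg_maxP => // i _ h j; apply: h.
have vL1 : row i (spectralmx L1) *m L1 = (f i)%:C *: row i (spectralmx L1).
  by rewrite spectral_row // fE.
exists (row i (spectralmx L1)), (f i); split=> //.
  by rewrite row_unitary // spectral_unitarymx.
apply/eqP/negP => /negP vLm0.
have vLmL1 : row i (spectralmx L1) *m Lm *m L1 =
    ((f i + 1)%:C) *: (row i (spectralmx L1) *m Lm).
  have -> : row i (spectralmx L1) *m Lm *m L1 =
      row i (spectralmx L1) *m L1 *m Lm + row i (spectralmx L1) *m Lm.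
    by rewrite -!mulmxA commL1m mulmxBr subrK.
  by rewrite vL1 -scalemxAl rmorphD scalerDl scale1r.
have [k] := herm_eigenval_spectral L1hs vLmL1 vLm0.
rewrite fE => /complexI fk; have := imax k; rewrite -fk; lra.
Qed.

Section Ladder.
Variables (v : 'rV[C]_n.+1) (m : R).
Hypotheses (v1 : '[v] = 1) (vL1 : v *m L1 = m%:C *: v) (vLm : v *m Lm = 0).

Let w j := iter j (fun u => u *m Lp) v.
(** The factor picked up by a step down followed by a step up; it is also the ratio of consecutive
    squared norms, which yields its sign. *)
Let c j : R := j.+1%:R * (2 * m - j%:R).

Let wL1 j : w j *m L1 = (m - j%:R)%:C *: w j.
Proof.
elim: j => [|j IH]; first by rewrite subr0.
have -> : w j.+1 *m L1 = w j *m L1 *m Lp - w j *m Lp.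
  by rewrite -!mulmxA commL1p mulmxDr addrK mulmxA.
rewrite IH -scalemxAl -[X in _ - X]scale1r -scalerBl; congr (_ *: _).
by rewrite -rmorphB -natr1 opprD addrA.
Qed.

Let wLm j : w j.+1 *m Lm = (c j)%:C *: w j.
Proof.
have rec i : w i.+1 *m Lm = w i *m Lm *m Lp + (2 * (m - i%:R))%:C *: w i.
  have -> : w i.+1 *m Lm = w i *m Lm *m Lp + 2 *: (w i *m L1).
    by rewrite -!mulmxA commpm mulmxDr -scalemxAr.
  by rewrite wL1 scalerA rmorphM /= rmorph_nat.
elim: j => [|j IH].
  rewrite rec /= vLm mul0mx add0r; congr (_%:C *: _).
  by rewrite /c; ring.
rewrite rec IH -scalemxAl -scalerDl -rmorphD; congr (_%:C *: _).
rewrite /c; ring.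
Qed.

Let w_dot j : '[w j.+1] = (c j)%:C * '[w j].
Proof.
have -> : '[w j.+1] = '[w j.+1 *m Lm, w j].
  by rewrite [RHS]dotmxMl -Lph trmxCK.
by rewrite wLm dotmxZl.
Qed.

(** If no [w j] vanished, every [c j] would be nonnegative as a ratio of squared norms, but it is
    negative once j > |2 m|. *)
Let w_stop : exists2 N, (forall j, (j <= N)%N -> w j != 0) & w N.+1 = 0.
Proof.
have [|no] := pselect (exists j, w j == 0).
  move=> /ex_minnP[[|N] wN0 Nmin].
    by move/eqP: wN0 v1 => /= ->; rewrite dotmxE mul0mx mxE => /esym/eqP; rewrite oner_eq0.
  exists N; last exact/eqP.
  by move=> j jN; apply/negP => /Nmin; rewrite leqNgt ltnS jN.
have wn0 j : w j != 0 by apply/negP => wj; apply: no; exists j.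
have c0 j : 0 <= c j.
  have := @dotmx_ge0 C _ (w j.+1); rewrite w_dot pmulr_lge0 ?ler0c //.
  exact: dotmx_is_dotmx.
pose j := Num.bound `|2 * m|; have := c0 j; rewrite /c pmulr_rge0 ?ltr0n //.
have : `|2 * m| < j%:R by rewrite archi_boundP.
have := ler_norm (2 * m); lra.
Qed.

Let w_ortho i j : i != j -> '[w i, w j] = 0.
Proof.
move=> ij; apply: (herm_eigenvec_ortho L1h (wL1 i) (wL1 j)).
  by rewrite complex_real.
by apply: contra ij => /eqP/complexI h; rewrite -(eqr_nat R); apply/eqP; lra.
Qed.

Let trL (L : 'M[C]_n.+1) : L^t* = L -> L^T = L ^ (@Num.conj C).
Proof. by move=> Lh; rewrite -[in RHS]Lh map_mxCK. Qed.

(** The span of w 0, ..., w N is stable under [L1], [Lp] and [Lm], hence under all generators, so it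
    is everything by irreducibility. These N + 1 nonzero vectors are pairwise orthogonal, and
    counting dimensions gives N = n. *)
Let full_span N : (forall j, (j <= N)%N -> w j != 0) -> w N.+1 = 0 -> N = n.
Proof.
move=> wn0 wN; pose V := \matrix_(j < N.+1) w j.
have wV j : (j <= N)%N -> (w j <= V)%MS.
  move=> jN; have := row_sub (inord j : 'I_N.+1) V.
  by rewrite rowK inordK ?ltnS.
have stabV A : (forall j, (j <= N)%N -> (w j *m A <= V)%MS) -> (V *m A <= V)%MS.
  move=> wA; apply/row_subP => j; rewrite row_mul rowK; apply: wA.
  by rewrite -ltnS.
have V1 : (V *m L1 <= V)%MS.
  by apply: stabV => j jN; rewrite wL1 scalemx_sub ?wV.
have Vp : (V *m Lp <= V)%MS.
  apply: stabV => j; rewrite leq_eqVlt => /orP[/eqP ->|jN].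
    by rewrite -[_ *m _]/(w N.+1) wN sub0mx.
  exact: (wV j.+1 jN).
have Vm : (V *m Lm <= V)%MS.
  apply: stabV => -[|j] jN; first by rewrite vLm sub0mx.
  by rewrite wLm scalemx_sub // wV // ltnW.
have i0 : ('i%C : C) != 0 by rewrite eq_complex /= oner_eq0 andbF.
have V2 : (V *m L2 <= V)%MS.
  have -> : L2 = 2^-1 *: (Lp + Lm).
    by rewrite /Lp /Lm addrACA subrr addr0 -mulr2n -(scaler_nat _ L2) scalerA mulVf ?scale1r.
  by rewrite -scalemxAr mulmxDr scalemx_sub // addmx_sub.
have V3 : (V *m L3 <= V)%MS.
  have -> : L3 = (2 * 'i%C)^-1 *: (Lp - Lm).
    rewrite /Lp /Lm opprB addrC addrA subrK -mulr2n -(scaler_nat _ (_ *: L3)) !scalerA.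
    by rewrite mulVf ?scale1r // mulf_neq0.
  by rewrite -scalemxAr mulmxBr scalemx_sub // addmx_sub // -scaleN1r scalemx_sub.
(* Irreducibility speaks of the transposes, and the transpose of a self-adjoint matrix is its
   entrywise conjugate: the subspace to test is the conjugated span. The brackets make its matrix
   square. *)
pose W := <<V>>%MS ^ (@Num.conj C).
have stabW L : L^t* = L -> (V *m L <= V)%MS -> stablemx W L^T.
  move=> Lh VL; rewrite trL // -map_mxM map_submx genmxE.
  by rewrite (eqmxMr _ (genmxE V)).
have [_ [_ _ _ [_ irr]]] := spinL.
have rkW : \rank W = \rank V by rewrite mxrank_map genmxE.
have rkV : \rank V = n.+1.
  have [] := irr W (stabW _ L1h V1) (stabW _ L2h V2) (stabW _ L3h V3) => //.
    rewrite rkW => /eqP; rewrite mxrank_eq0 => /eqP V0.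
    have : (w 0 <= V)%MS := wV 0%N isT.
    by rewrite V0 => /submx0null /eqP w0; have := wn0 0%N isT; rewrite w0.
  by rewrite rkW.
apply/eqP; rewrite eqn_leq -ltnS -rkV; apply/andP; split; last first.
  by rewrite -ltnS -rkV rank_leq_row.
apply: leq_trans (mxrankM_maxl V (V^t*)).
rewrite mxrank_unit //.
  have -> : V *m V^t* = diag_mx (\row_j '[w j]).
    apply/matrixP => i j; rewrite !mxE.
    transitivity '[w i, w j].
      by rewrite dotmxE mxE; apply: eq_bigr => k _; rewrite !mxE.
    by have [->|ij] := eqVneq i j; rewrite ?mulr1n // w_ortho.
  rewrite unitmxE det_diag unitfE; apply/prodf_neq0 => j _; rewrite mxE.
  by apply: contra (wn0 j _) => [/eqP/dotmx_eq0 -> //|]; rewrite -ltnS.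
Qed.

(** The ladder stops after w n, and w n is nonzero, so the factor [c n] must be 0. *)
Let m2n : 2 * m = n%:R.
Proof.
have [N wn0 wN] := w_stop; have Nn := full_span wn0 wN.
have := w_dot N; rewrite wN dotmxE mul0mx mxE => /esym/eqP; rewrite mulf_eq0.
case/orP => [/eqP/complexI/eqP|/eqP/dotmx_eq0 w0]; last first.
  by have := wn0 N (leqnn N); rewrite w0 eqxx.
by rewrite mulf_eq0 pnatr_eq0 /= subr_eq0 Nn => /eqP.
Qed.

Let w_normsq j : '[w j] = (j`! ^ 2 * 'C(n, j))%:R.
Proof.
elim: j => [|j IH]; first by rewrite bin0 v1.
rewrite w_dot IH /c m2n; have [jn|nj] := leqP j n; last first.
  by rewrite (bin_small nj) (bin_small (leqW nj)) !muln0 mulr0.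
rewrite -natrB // -natrM -(rmorph_nat (@real_complex_def R (Phant R))) -rmorphM.
rewrite -natrM -[RHS](rmorph_nat (@real_complex_def R (Phant R))); congr (_%:R%:C).
by rewrite factS expnMn mulnACA -mul_bin_left mulnACA mulnn mulnA.
Qed.

Let ladderE (u : 'rV[C]_n.+1) : 2 *: (u *m L2) = u *m Lp + u *m Lm.
Proof.
rewrite -mulmxDr scalemxAr /Lp /Lm addrACA subrr addr0 -mulr2n.
by rewrite -(scaler_nat _ L2).
Qed.

Let fact_neq0 j : (j`!%:R : C) != 0.
Proof. by rewrite pnatr_eq0 -lt0n fact_gt0. Qed.

(** Dividing w j by j! turns the squared norms into binomial coefficients and the action of 2 L2
    into the three-term recurrence of the coefficients of (1 + X)^(n - k) (1 - X)^k. The family runs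
    over all naturals and vanishes past n, so the recurrence has no upper boundary case. *)
Lemma ladder_basis : exists e : nat -> 'rV[C]_n.+1,
  [/\ forall j, e j *m L1 = (n%:R / 2 - j%:R)%:C *: e j,
      2 *: (e 0%N *m L2) = e 1%N,
      forall j, 2 *: (e j.+1 *m L2) =
        j.+2%:R *: e j.+2 + (n%:R - j%:R) *: e j,
      forall j, '[e j] = 'C(n, j)%:R &
      forall i j, i != j -> '[e i, e j] = 0].
Proof.
pose e j := (j`!%:R)^-1 *: w j; exists e.
have ep j : e j *m Lp = j.+1%:R *: e j.+1.
  rewrite /e -scalemxAl scalerA factS natrM invfM mulrA mulfV ?pnatr_eq0 //.
  by rewrite mul1r.
have em j : e j.+1 *m Lm = (n%:R - j%:R) *: e j.
  rewrite /e -scalemxAl wLm /c m2n !scalerA; congr (_ *: _).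
  rewrite factS natrM invfM rmorphM rmorphB !rmorph_nat.
  by rewrite mulrACA mulVf ?pnatr_eq0 // mul1r mulrC.
split.
- move=> j; rewrite /e -scalemxAl wL1 !scalerA mulrC; congr ((_ - _)%:C * _ *: _).
  by rewrite -m2n; field.
- by rewrite ladderE ep scale1r /e -scalemxAl vLm scaler0 addr0.
- by move=> j; rewrite ladderE ep em.
- move=> j; rewrite /e dotmxZ w_normsq natrM natrX normfV normr_nat exprVn.
  by rewrite mulKf // expf_neq0.
by move=> i j ij; rewrite /e dotmxZl dotmxZr w_ortho // !mulr0.
Qed.

End Ladder.

Lemma spin_ladder : exists e : nat -> 'rV[C]_n.+1,
  [/\ forall j, e j *m L1 = (n%:R / 2 - j%:R)%:C *: e j,
      2 *: (e 0%N *m L2) = e 1%N,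
      forall j, 2 *: (e j.+1 *m L2) =
        j.+2%:R *: e j.+2 + (n%:R - j%:R) *: e j,
      forall j, '[e j] = 'C(n, j)%:R &
      forall i j, i != j -> '[e i, e j] = 0].
Proof.
by have [v [m [v1 vL1 vLm]]] := exists_top_vector; exact: (ladder_basis v1 vL1).
Qed.

End Representation.

(** The half-turn about the bisector of the first two axes. It carries the ladder of [L1] over to
    [L2]. *)
Lemma spin_rep_swap n (L1 L2 L3 : 'M[C]_n) :
  spin_rep L1 L2 L3 -> spin_rep L2 L1 (- L3).
Proof.
move=> [[h1 h2 h3] [c12 c23 c31 [n0 irr]]].
have cC (A B : 'M[C]_n) : commutator A B = - commutator B A.
  by rewrite /commutator opprB.
have cN (A B : 'M[C]_n) : commutator A (- B) = commutator B A.
  by rewrite /commutator mulmxN mulNmx opprK addrC.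
split; first (split; [exact: h2|exact: h1|]).
  by apply: hermsymmx_intro; rewrite linearN map_mxN (hermsymmxP h3).
split.
- by rewrite cC c12 scalerN.
- by rewrite cN c31.
- by rewrite cC cN -cC c23.
split=> // W W2 W1 W3; apply: irr => //.
by move: W3; rewrite linearN /= mulmxN eqmx_opp.
Qed.

End SpinLadder.

(** * Real estimates *)

Section RealEstimates.
Variable R : realType.
Implicit Types (A M c p x y : R).

(** Telescoping: (A + d) (A + d + 1) <= 4 (A^2 + d^2) when A >= 1. *)
Lemma sum_inv_sqr_le A m : 1 <= A ->
  \sum_(d < m) (A ^+ 2 + d%:R ^+ 2)^-1 <= 4 / A.
Proof.
move=> A1.
have term d : (A ^+ 2 + d%:R ^+ 2)^-1 <= 4 / (A + d%:R) - 4 / (A + d.+1%:R).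
  have d0 : 0 <= (d%:R : R) by rewrite ler0n.
  rewrite -(natr1 d); set t : R := d%:R in d0 *.
  have -> : 4 / (A + t) - 4 / (A + (t + 1)) = 4 / ((A + t) * (A + t + 1)).
    by field; apply/andP; split; apply/eqP; lra.
  rewrite -[leLHS]mul1r ler_pdivlMr; last by nra.
  have AA : A <= A ^+ 2 by rewrite expr2 ler_peMl //; lra.
  rewrite mulrAC ler_pdivrMr; nra.
apply: le_trans (_ : 4 / A - 4 / (A + m%:R) <= _); last first.
  by rewrite gerBl divr_ge0 // addr_ge0 ?ler0n //; lra.
elim: m => [|m IH]; first by rewrite big_ord0 addr0 subrr.
by rewrite big_ord_recr /=; have := term m; lra.
Qed.

(** With y cos y <= sin y at y = x / 2, sin x = 2 sin y cos y is at least x cos^2 (x / 2) = x (1 +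
    cos x) / 2. *)
Lemma sin_ge_half x : 0 <= x -> x <= pi / 2 -> x / 2 <= sin x.
Proof.
move=> x0 xpi.
have step y : 0 <= y -> y <= pi / 2 -> y * cos y <= sin y.
  move=> y0 ypi; pose f (t : R) := sin t - t * cos t.
  have df (t : R) : is_derive t 1 f (t * sin t).
    by apply: is_derive_eq; rewrite /GRing.scale /=; ring.
  have : f 0 <= f y.
    apply: (@ger0_derive1_ndecr _ f 0 y) => //.
    - by move=> t; rewrite in_itv /= => /andP[t0 ty]; rewrite derive1E derive_val mulr_ge0 ?sin_ge0_pi ?(ltW t0) //=; have := pi_gt0 R; lra.
    - by apply: derivable_within_continuous => t _; exact: ex_derive.
  by rewrite /f sin0 mul0r subr0; lra.
have c0 : 0 <= cos x by apply: cos_ge0_pihalf; have := pi_gt0 R; lra.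
have h : x / 2 * cos (x / 2) <= sin (x / 2) by apply: step; lra.
have -> : sin x = 2 * (cos (x / 2) * sin (x / 2)).
  by rewrite mulrC mulr_natr -sin_mulr2n; congr sin; rewrite mulr2n; lra.
have ch : 0 <= cos (x / 2) by apply: cos_ge0_pihalf; have := pi_gt0 R; lra.
have : cos x = cos (x / 2) ^+ 2 *+ 2 - 1.
  by rewrite -cos_mulr2n; congr cos; rewrite mulr2n; lra.
rewrite mulr2n => cE; nra.
Qed.

(** The quadratic rate is the best uniform one, cosine being stationary at 0 and pi. With D the half
    difference and s the half sum, the gap is 2 sin s sin D, where sin s >= sin D >= D / 2. *)
Lemma cos_spacing x y : 0 <= x -> x <= pi -> 0 <= y -> y <= pi ->
  (x - y) ^+ 2 / 8 <= `|cos x - cos y|.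
Proof.
wlog xy : x y / x <= y.
  move=> H x0 xp y0 yp; have [xy|/ltW yx] := leP x y; first exact: H.
  by rewrite distrC -sqrrN opprB; apply: H.
move=> x0 xp y0 yp; set D := (y - x) / 2; set s := (x + y) / 2.
have cD : cos x - cos y = 2 * (sin s * sin D).
  have -> : x = s - D by rewrite /s /D; field.
  have -> : y = s + D by rewrite /s /D; field.
  by rewrite cosB cosD; ring.
have D0 : 0 <= D by rewrite /D; lra.
have D1 : D <= pi / 2 by rewrite /D; lra.
have sD : sin D <= sin s.
  have -> : s = x + D by rewrite /s /D; field.
  have -> : sin (x + D) = sin ((x / 2 + D) + x / 2) by congr sin; field.
  have {1}-> : D = (x / 2 + D) - x / 2 by field.
  rewrite sinB [leRHS]sinD.
  have : 0 <= cos (x / 2 + D) * sin (x / 2).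
    rewrite mulr_ge0 //.
      by apply: cos_ge0_pihalf; rewrite /D; have := pi_gt0 R; lra.
    by apply: sin_ge0_pi; lra.
  lra.
have hD := sin_ge_half D0 D1.
rewrite cD ger0_norm; last by rewrite !mulr_ge0 //; lra.
have -> : x - y = - (2 * D) by rewrite /D; field.
nra.
Qed.

(** This is u^e <= exp(e (u - 1)) for u = x / a. Writing the exponent as m a^2 removes the division,
    so that a = 0 is covered too. *)
Lemma pow_le_expR (x a m : R) (e : nat) : 0 <= x -> 0 <= a -> e%:R = m * a ^+ 2 ->
  x ^+ e <= a ^+ e * expR (m * (x * a - a ^+ 2)).
Proof.
move=> x0 a0 em; have [a_eq0|an0] := eqVneq a 0.
  move: em; rewrite a_eq0 expr0n mulr0 => /eqP; rewrite pnatr_eq0 => /eqP ->.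
  by rewrite !expr0 !mulr0 subrr mulr0 expR0 mulr1.
have ap : 0 < a by rewrite lt_def an0.
have -> : m * (x * a - a ^+ 2) = e%:R * (x / a - 1).
  by rewrite em; field.
rewrite expRM_natl -exprMn lerXn2r ?nnegrE ?mulr_ge0 ?expR_ge0 //.
rewrite -ler_pdivrMl // mulrC; have := expR_ge1Dx (x / a - 1); lra.
Qed.

(* 1 - (s S + c C) is half a squared Hellinger distance. *)
Lemma hellinger (s c S C : R) : s ^+ 2 + c ^+ 2 = 1 -> S ^+ 2 + C ^+ 2 = 1 ->
  s * S + c * C - 1 <= - ((s ^+ 2 - S ^+ 2) ^+ 2 / 2).
Proof.
move=> sc SC; set t := s * S + c * C.
have tE : 1 - t ^+ 2 = (s * C - c * S) ^+ 2.
  have -> : 1 = (s ^+ 2 + c ^+ 2) * (S ^+ 2 + C ^+ 2) by rewrite sc SC mulr1.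
  by rewrite /t; ring.
have uE : 1 - (c * C - s * S) ^+ 2 = (s * C + c * S) ^+ 2.
  have -> : 1 = (s ^+ 2 + c ^+ 2) * (S ^+ 2 + C ^+ 2) by rewrite sc SC mulr1.
  by ring.
have dE : s ^+ 2 - S ^+ 2 = (s * C - c * S) * (s * C + c * S).
  have -> : s ^+ 2 - S ^+ 2 = s ^+ 2 * (S ^+ 2 + C ^+ 2) - S ^+ 2 * (s ^+ 2 + c ^+ 2).
    by rewrite sc SC !mulr1.
  by ring.
rewrite dE exprMn -tE -uE.
have u0 : 0 <= 1 - t ^+ 2 by rewrite tE sqr_ge0.
have := ler_wpM2l u0 (_ : 1 - (c * C - s * S) ^+ 2 <= 1).
rewrite gerBl sqr_ge0 mulr1 => /(_ isT) h.
have := sqr_ge0 (1 - t); rewrite -/t; lra.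
Qed.

(** The left side is largest at p = 1 - k/n. [pow_le_expR] for both factors leaves n times the
    expression that [hellinger] bounds. *)
Lemma binomial_gaussian_bound (n k : nat) (p : R) : (0 < n)%N -> (k <= n)%N ->
    0 <= p -> p <= 1 ->
  Num.sqrt p ^+ (n - k) * Num.sqrt (1 - p) ^+ k <=
  Num.sqrt (1 - k%:R / n%:R) ^+ (n - k) * Num.sqrt (k%:R / n%:R) ^+ k *
  expR (- (n%:R / 2 * (p - (1 - k%:R / n%:R)) ^+ 2)).
Proof.
move=> n0 kn p0 p1; have nR : 0 < n%:R :> R by rewrite ltr0n.
have nR0 : n%:R != 0 :> R by rewrite gt_eqF.
set q := k%:R / n%:R.
have q0 : 0 <= q by rewrite divr_ge0.
have q1 : q <= 1 by rewrite ler_pdivrMr // mul1r ler_nat.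
have h1 : Num.sqrt p ^+ (n - k) <= Num.sqrt (1 - q) ^+ (n - k) *
    expR (n%:R * (Num.sqrt p * Num.sqrt (1 - q) - Num.sqrt (1 - q) ^+ 2)).
  apply: pow_le_expR; rewrite ?sqrtr_ge0 // sqr_sqrtr; last by lra.
  by rewrite natrB // /q; field.
have h2 : Num.sqrt (1 - p) ^+ k <= Num.sqrt q ^+ k *
    expR (n%:R * (Num.sqrt (1 - p) * Num.sqrt q - Num.sqrt q ^+ 2)).
  by apply: pow_le_expR; rewrite ?sqrtr_ge0 // sqr_sqrtr // /q; field.
apply: le_trans (ler_pM _ _ h1 h2) _; rewrite ?exprn_ge0 ?sqrtr_ge0 //.
rewrite mulrACA -expRD; apply: ler_wpM2l; first by rewrite mulr_ge0 ?exprn_ge0 ?sqrtr_ge0.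
rewrite ler_expR -mulrDr.
have s1 : Num.sqrt p ^+ 2 + Num.sqrt (1 - p) ^+ 2 = 1.
  by rewrite !sqr_sqrtr; lra.
have s2 : Num.sqrt (1 - q) ^+ 2 + Num.sqrt q ^+ 2 = 1.
  by rewrite !sqr_sqrtr; lra.
have := hellinger s1 s2; rewrite (sqr_sqrtr p0) (@sqr_sqrtr _ (1 - q)); last by lra.
move=> h; have := ler_wpM2l (ltW nR) h; rewrite (sqr_sqrtr q0); lra.
Qed.

End RealEstimates.

(** * Gaussian sums over a grid of cosines *)

Section GaussCos.
Variable R : realType.
Implicit Types (A M c p x y : R).

(** Under truncated subtraction the argument of [F] is the distance |i - i0|, and each distance is
    attained at most twice. *)
Lemma sum_dist_le (F : nat -> R) (m i0 : nat) : (forall d, 0 <= F d) -> (i0 < m)%N ->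
  \sum_(i < m) F (i - i0 + (i0 - i))%N <= 2 * \sum_(d < m) F d.
Proof.
move=> F0 im.
have mono a b : (a <= b)%N -> \sum_(0 <= d < a) F d <= \sum_(0 <= d < b) F d.
  move=> ab; rewrite [leRHS](big_cat_nat (n := a)) //= lerDl sumr_ge0 //.
rewrite -!(big_mkord xpredT (fun d => F (d - i0 + (i0 - d))%N)).
rewrite -(big_mkord xpredT F) (big_cat_nat (n := i0)) ?(ltnW im) //=.
rewrite mulr2n mulrDl !mul1r; apply: lerD.
  rewrite big_nat_rev /= add0n.
  apply: le_trans (_ : \sum_(0 <= d < i0) F d.+1 <= _).
    rewrite !big_nat; apply: ler_sum => d /andP[_ di].
    by rewrite (_ : (i0 - d.+1 - i0 + (i0 - (i0 - d.+1)))%N = d.+1) //; lia.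
  apply: le_trans (_ : \sum_(0 <= d < i0.+1) F d <= _); last exact: mono.
  by rewrite big_nat_recl // lerDr.
rewrite -{1}(add0n i0) big_addn; apply: le_trans (mono (m - i0)%N m (leq_subr _ _)).
rewrite !big_nat; apply: ler_sum => d _.
by rewrite (_ : (d + i0 - i0 + (i0 - (d + i0)))%N = d) //; lia.
Qed.

Lemma expRN_le_inv y : 0 <= y -> expR (- y) <= (1 + y)^-1.
Proof.
move=> y0; rewrite expRN lef_pV2 ?posrE ?expR_gt0 //; last by lra.
exact: expR_ge1Dx.
Qed.

(* The point of the grid closest to c plays the role of c, up to a factor 2. *)
Lemma gauss_cos_sum (h : nat) M c : (0 < h)%N -> 0 < M -> M <= h%:R ^+ 4 ->
  \sum_(i < h.+1) expR (- (M * (cos (pi * i%:R / h%:R) - c) ^+ 2))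
  <= 32 * h%:R / Num.sqrt (Num.sqrt M).
Proof.
move=> h0 M0 Mh; have hR : 0 < h%:R :> R by rewrite ltr0n.
set a := Num.sqrt (Num.sqrt M).
have a0 : 0 < a by rewrite !sqrtr_gt0.
have a4 : a ^+ 4 = M by rewrite (exprM a 2 2) !sqr_sqrtr ?sqrtr_ge0 ?ltW.
have ah : a <= h%:R by rewrite -(@ler_pXn2r _ 4) ?nnegrE ?a4 // ltW.
(* The width of the peak in grid steps: d steps move the cosine by order (d / h)^2, so the exponent
   reaches order 1 when d is of order h / M^(1/4). The assumption M <= h^4 makes this width at least
   1. *)
pose A := 2 * h%:R / a.
have A1 : 1 <= A by rewrite ler_pdivlMr //; lra.
pose x (i : nat) : R := pi * i%:R / h%:R.
have xpi (i : 'I_h.+1) : 0 <= x i /\ x i <= pi.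
  have p0 := pi_gt0 R; split; first by rewrite !mulr_ge0 ?invr_ge0 // ltW.
  by rewrite /x ler_pdivrMr // ler_pM2l // ler_nat -ltnS.
have [i0 i0min] : exists i0 : 'I_h.+1, forall i : 'I_h.+1,
    `|cos (x i0) - c| <= `|cos (x i) - c|.
  exists [arg min_(i < (ord0 : 'I_h.+1)) `|cos (x i) - c|]%O.
  by case: arg_minP => // i _ hi j; apply: hi.
pose F (d : nat) := 2 * A ^+ 2 * (A ^+ 2 + d%:R ^+ 2)^-1.
have A2 : 0 < A ^+ 2 by rewrite exprn_gt0 //; lra.
have F0 d : 0 <= F d.
  by rewrite /F mulr_ge0 ?invr_ge0 ?addr_ge0 ?sqr_ge0 // mulr_ge0 // sqr_ge0.
have term (i : 'I_h.+1) : expR (- (M * (cos (pi * i%:R / h%:R) - c) ^+ 2))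
    <= F (i - i0 + (i0 - i))%N.
  rewrite -/(x i); set d := (_ + _)%N.
  have dE : (d%:R : R) ^+ 2 = (i%:R - i0%:R) ^+ 2.
    rewrite /d; have [ii|/ltnW ii] := leqP i0 i.
      by rewrite (eqP ii) addn0 natrB.
    by rewrite (eqP ii) add0n natrB // -sqrrN opprB.
  have [x0 x1] := xpi i; have [y0 y1] := xpi i0.
  have sp := cos_spacing x0 x1 y0 y1.
  have tri : `|cos (x i) - cos (x i0)| <= `|cos (x i) - c| + `|cos (x i0) - c|.
    rewrite (distrC (cos (x i0))) (_ : cos (x i) - cos (x i0) =
      (cos (x i) - c) + (c - cos (x i0))); [exact: ler_normD|ring].
  have := i0min i => mini.
  have dist : d%:R ^+ 2 / (4 * h%:R ^+ 2) <= `|cos (x i) - c|.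
    have -> : d%:R ^+ 2 / (4 * h%:R ^+ 2) =
        (2 / h%:R * (i%:R - i0%:R)) ^+ 2 / 8 / 2 :> R.
      by rewrite dE; field; rewrite gt_eqF.
    have : (2 / h%:R * (i%:R - i0%:R)) ^+ 2 <= (x i - x i0) ^+ 2.
      have -> : x i - x i0 = pi / h%:R * (i%:R - i0%:R).
        by rewrite /x; field; rewrite gt_eqF.
      rewrite !exprMn ler_wpM2r ?sqr_ge0 // ler_wpM2r ?sqr_ge0 //.
      by rewrite ler_sqr ?nnegrE ?pi_ge0 // pi_ge2.
    lra.
  (* The Gaussian is traded for a summable tail: exp(-u^2) <= 1 / (1 + u^2) <= 2 / (1 + u). *)
  pose u := d%:R ^+ 2 / A ^+ 2.
  have u0 : 0 <= u by rewrite divr_ge0 ?sqr_ge0.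
  have uM : u ^+ 2 <= M * (cos (x i) - c) ^+ 2.
    have -> : u = a ^+ 2 * (d%:R ^+ 2 / (4 * h%:R ^+ 2)).
      by rewrite /u /A; field; rewrite !gt_eqF.
    rewrite exprMn -exprM a4 ler_pM2l // -(real_normK (num_real (_ - c))).
    by rewrite ler_sqr ?nnegrE // divr_ge0 ?sqr_ge0 // mulr_ge0 // sqr_ge0.
  apply: le_trans (_ : expR (- u ^+ 2) <= _); first by rewrite ler_expR lerN2.
  apply: le_trans (expRN_le_inv (sqr_ge0 u)) _.
  have -> : F d = 2 / (1 + u).
    rewrite /F /u; move: A2 (sqr_ge0 (d%:R : R)).
    by move: (A ^+ 2) (d%:R ^+ 2) => B D B0 D0; field; apply/andP; split; apply/eqP; lra.
  rewrite ler_pdivlMr; last by lra.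
  rewrite mulrC ler_pdivrMr; nra.
apply: le_trans (ler_sum _ (fun i _ => term i)) _.
apply: le_trans (sum_dist_le F0 (ltn_ord i0)) _.
rewrite /F -mulr_sumr.
have A4 : 0 <= 4 * A ^+ 2 by rewrite mulr_ge0 // ltW.
have := ler_wpM2l A4 (sum_inv_sqr_le h.+1 A1).
have -> : 4 * A ^+ 2 * (4 / A) = 32 * h%:R / a.
  by rewrite /A; field; rewrite !gt_eqF.
by apply: le_trans; rewrite mulrA le_eqVlt; apply/orP; left; apply/eqP; congr (_ * _); ring.
Qed.

End GaussCos.

(** * Stirling bounds with explicit constants *)

Section Stirling.
Variable R : realType.
Implicit Types (x y t : R).

Lemma is_derive_ln1D t : -1 < t -> is_derive t 1 (fun s : R => ln (1 + s)) (1 + t)^-1.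
Proof.
move=> t1; have h : is_derive (1 + t) 1 (@ln R) (1 + t)^-1.
  by apply: is_derive1_ln; lra.
have h2 : is_derive t 1 (fun s : R => 1 + s) 1.
  apply: is_derive_eq.
  by rewrite add0r mulr1.
have := @is_derive1_comp _ (@ln R) (fun s : R => 1 + s) t _ _ h h2.
by rewrite mulr1.
Qed.

Lemma derive_ge0_ndecr (f df : R -> R) x : 0 <= x ->
    (forall t, 0 <= t -> is_derive t 1 f (df t)) ->
    (forall t, 0 <= t -> 0 <= df t) ->
  f 0 <= f x.
Proof.
move=> x0 fd d0; apply: (@ger0_derive1_ndecr _ f 0 x) => //.
- by move=> t; rewrite in_itv /= => /andP[/ltW/fd ? _]; apply: ex_derive.
- move=> t; rewrite in_itv /= => /andP[/ltW t0 _].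
  by have ? := fd t t0; rewrite derive1E derive_val d0.
- apply: derivable_within_continuous => t; rewrite in_itv /= => /andP[/fd ? _].
  exact: ex_derive.
Qed.

Lemma ln1D_ge x : 0 <= x -> x - x ^+ 2 / 2 <= ln (1 + x).
Proof.
move=> x0; pose f (t : R) := ln (1 + t) - t + t ^+ 2 / 2.
have : f 0 <= f x.
  apply: (@derive_ge0_ndecr f (fun t => t ^+ 2 / (1 + t))) => // t t0.
    have h : is_derive t 1 (fun s : R => ln (1 + s)) (1 + t)^-1.
      by apply: is_derive_ln1D; lra.
    by apply: is_derive_eq; rewrite /GRing.scale /=; field; lra.
  by rewrite divr_ge0 ?sqr_ge0 //; lra.
by rewrite /f addr0 ln1 expr0n /=; lra.
Qed.

Lemma ln1D_le x : 0 <= x -> ln (1 + x) <= x - x ^+ 2 / 2 + x ^+ 3 / 3.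
Proof.
move=> x0; pose f (t : R) := t - t ^+ 2 / 2 + t ^+ 3 / 3 - ln (1 + t).
have : f 0 <= f x.
  apply: (@derive_ge0_ndecr f (fun t => t ^+ 3 / (1 + t)) x x0) => t t0.
    have h : is_derive t 1 (fun s : R => ln (1 + s)) (1 + t)^-1.
      by apply: is_derive_ln1D; lra.
    by apply: is_derive_eq; rewrite /GRing.scale /=; field; lra.
  by rewrite divr_ge0 ?exprn_ge0 //; lra.
by rewrite /f addr0 ln1 !expr0n /=; lra.
Qed.

(** Stirling's formula without its constant ln sqrt(2 pi). The value at k = 1 is 1, the centre used
    in [stirling_bound]. *)
Definition stirling_err (k : nat) : R :=
  ln k`!%:R - ((k%:R + 2^-1) * ln k%:R - k%:R).

(** With x = 1/k the increment is 1 - (1/x + 1/2) ln (1 + x), of size at most x^2 / 4; the right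
    side is x^2 / (2 (1 + x)), in a form that telescopes. *)
Lemma stirling_step (k : nat) : (0 < k)%N ->
  `|stirling_err k.+1 - stirling_err k| <= 2^-1 * (k%:R^-1 - k.+1%:R^-1).
Proof.
move=> k0; have kR : 0 < k%:R :> R by rewrite ltr0n.
have k1 : 1 <= k%:R :> R by rewrite ler1n.
have k0' : k%:R != 0 :> R by rewrite gt_eqF.
pose x : R := k%:R^-1.
have x0 : 0 < x by rewrite invr_gt0.
have x1 : x <= 1 by rewrite invf_le1.
have kx : k%:R = x^-1 by rewrite invrK.
have lnS : ln k.+1%:R = ln k%:R + ln (1 + x) :> R.
  by rewrite -lnM ?posrE //; [congr ln; rewrite -natr1 /x; field|lra].
have -> : stirling_err k.+1 - stirling_err k = 1 - (x^-1 + 2^-1) * ln (1 + x).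
  rewrite /stirling_err factS natrM lnM ?posrE ?ltr0n ?fact_gt0 // lnS -natr1 kx.
  by ring.
have lo := ln1D_ge (ltW x0); have hi := ln1D_le (ltW x0).
have c0 : 0 < x^-1 + 2^-1 by rewrite addr_gt0 ?invr_gt0.
have {}lo := ler_wpM2l (ltW c0) lo; have {}hi := ler_wpM2l (ltW c0) hi.
have loE : (x^-1 + 2^-1) * (x - x ^+ 2 / 2) = 1 - x ^+ 2 / 4 by field; rewrite gt_eqF.
have hiE : (x^-1 + 2^-1) * (x - x ^+ 2 / 2 + x ^+ 3 / 3) = 1 + x ^+ 2 / 12 + x ^+ 3 / 6.
  by field; rewrite gt_eqF.
rewrite loE in lo; rewrite hiE in hi.
have x3 : x ^+ 3 <= x ^+ 2 by rewrite ler_wiXn2l // ltW.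
have -> : k%:R^-1 - k.+1%:R^-1 = x ^+ 2 / (1 + x).
  rewrite -natr1 /x; move: k%:R kR => y y0.
  by field; repeat (apply/andP; split); apply/eqP; lra.
have : x ^+ 2 / 2 <= x ^+ 2 / (1 + x).
  rewrite ler_wpM2l ?sqr_ge0 // lef_pV2 ?posrE; lra.
rewrite ler_norml; have := sqr_ge0 x; lra.
Qed.

Lemma stirling_bound (k : nat) : (0 < k)%N -> `|stirling_err k - 1| <= 2^-1.
Proof.
case: k => // k _; suff : `|stirling_err k.+1 - 1| <= 2^-1 * (1 - k.+1%:R^-1).
  move/le_trans; apply; rewrite ger_pMr // gerBl invr_ge0 //.
elim: k => [|k IH].
  rewrite /stirling_err (_ : 1`! = 1%N) // ln1 mulr0 invr1 subrr mulr0.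
  by rewrite (_ : 0 - (0 - 1) - 1 = 0) ?normr0 //; ring.
have tri := ler_normD (stirling_err k.+2 - stirling_err k.+1) (stirling_err k.+1 - 1).
rewrite subrKA in tri; apply: le_trans tri _.
apply: le_trans (lerD (stirling_step (ltn0Sn k)) IH) _.
by rewrite -mulrDr addrC subrKA.
Qed.

(** The mass at k of the binomial law with n trials and success probability k/n. *)
Definition binomial_mode (n k : nat) : R :=
  'C(n, k)%:R * ((k%:R / n%:R) ^+ k * (1 - k%:R / n%:R) ^+ (n - k)).

Lemma ln_binomial_mode n k : (0 < k < n)%N ->
  ln (binomial_mode n k) = 2^-1 * ln (n%:R / (k%:R * (n - k)%:R))
    + (stirling_err n - stirling_err k - stirling_err (n - k)).
Proof.
move=> /andP[k0 kn]; have n0 : (0 < n)%N by exact: leq_ltn_trans kn.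
have m0 : (0 < n - k)%N by rewrite subn_gt0.
have pos (i : nat) : (0 < i)%N -> i%:R \is @Num.pos R by rewrite posrE ltr0n.
have pf i : i`!%:R \is @Num.pos R by rewrite posrE ltr0n fact_gt0.
have nB : 1 - k%:R / n%:R = (n - k)%:R / n%:R :> R.
  by rewrite natrB ?(ltnW kn) //; field; rewrite pnatr_eq0 -lt0n.
have C0 : 'C(n, k)%:R \is @Num.pos R by rewrite posrE ltr0n bin_gt0 ltnW.
have lnC : ln n`!%:R = ln 'C(n, k)%:R + ln k`!%:R + ln (n - k)`!%:R :> R.
  rewrite -(bin_fact (ltnW kn)) !natrM lnM //; last by rewrite rpredM.
  by rewrite lnM // addrA.
have q0 i : (0 < i)%N -> i%:R / n%:R \is @Num.pos R.
  by move=> i0; rewrite posrE divr_gt0 // ltr0n.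
have lnq i e : (0 < i)%N -> ln ((i%:R / n%:R) ^+ e) = e%:R * (ln i%:R - ln n%:R) :> R.
  by move=> i0; rewrite lnXn ?divr_gt0 ?ltr0n // ln_div ?pos // mulr_natl.
have -> : ln (binomial_mode n k) = ln 'C(n, k)%:R +
    (k%:R * (ln k%:R - ln n%:R) + (n - k)%:R * (ln (n - k)%:R - ln n%:R)).
  rewrite /binomial_mode nB lnM ?rpredM ?rpredX ?q0 // lnM ?rpredX ?q0 //.
  by rewrite !lnq.
have -> : ln (n%:R / (k%:R * (n - k)%:R)) = ln n%:R - (ln k%:R + ln (n - k)%:R) :> R.
  by rewrite ln_div ?lnM ?rpredM ?pos.
rewrite /stirling_err lnC.
have -> : n%:R = k%:R + (n - k)%:R :> R by rewrite natrB ?(ltnW kn) // subrKC.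
move: (ln (k%:R + (n - k)%:R)) (ln k%:R) (ln (n - k)%:R) (ln 'C(n, k)%:R).
move: (ln k`!%:R) (ln (n - k)`!%:R) (k%:R : R) ((n - k)%:R : R) => *; by field.
Qed.

(** The three Stirling errors lie in [1/2, 3/2], so their combination lies in [-5/2, 1/2]; hence
    5/2. *)
Lemma binomial_mode_bounds n k : (0 < k < n)%N ->
  let v := Num.sqrt (n%:R / (k%:R * (n - k)%:R)) in
  v / expR (5 / 2) <= binomial_mode n k /\ binomial_mode n k <= expR (5 / 2) * v.
Proof.
move=> kn v; have lnb := ln_binomial_mode kn.
have /andP[k0 kn'] := kn; have n0 : (0 < n)%N by exact: leq_ltn_trans kn'.
have m0 : (0 < n - k)%N by rewrite subn_gt0.
have q0 : 0 < n%:R / (k%:R * (n - k)%:R) :> R by rewrite divr_gt0 ?mulr_gt0 ?ltr0n.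
have b0 : 0 < binomial_mode n k.
  rewrite /binomial_mode mulr_gt0 ?ltr0n ?bin_gt0 ?(ltnW kn') // mulr_gt0 ?exprn_gt0 ?divr_gt0 ?ltr0n //.
  by rewrite subr_gt0 ltr_pdivrMr ?ltr0n // mul1r ltr_nat.
have v0 : 0 < v by rewrite sqrtr_gt0.
have lnv : 2^-1 * ln (n%:R / (k%:R * (n - k)%:R)) = ln v.
  by rewrite -[in LHS](sqr_sqrtr (ltW q0)) lnXn // -mulr_natl -/v; field.
rewrite lnv in lnb.
have := stirling_bound n0; have := stirling_bound k0; have := stirling_bound m0.
rewrite !ler_norml => /andP[a1 a2] /andP[b1 b2] /andP[c1 c2].
rewrite -[binomial_mode n k](lnK _) ?posrE // -[v](lnK _) ?posrE //.
by rewrite -expRN -!expRD !ler_expR lnb; split; lra.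
Qed.

Lemma binomial_mode_le1 n k : (k <= n)%N -> binomial_mode n k <= 1.
Proof.
case: n => [|n] kn; first by move: kn; rewrite leqn0 /binomial_mode => /eqP ->; rewrite bin0 !expr0 !mulr1.
set q := k%:R / n.+1%:R : R.
have q0 : 0 <= q by rewrite divr_ge0.
have q1 : q <= 1 by rewrite ler_pdivrMr ?ltr0n // mul1r ler_nat.
have : (1 - q + q) ^+ n.+1 = 1 by rewrite subrK expr1n.
rewrite exprDn (bigD1 (Ordinal (kn : (k < n.+2)%N))) //= => <-.
rewrite -mulr_natl /binomial_mode -/q (mulrC (q ^+ k)) lerDl sumr_ge0 // => i _.
by rewrite mulrn_wge0 // mulr_ge0 ?exprn_ge0 // subr_ge0.
Qed.

End Stirling.

(** * The overlap bound *)

Section CoefExtraction.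
Local Open Scope complex_scope.
Variable R : realType.
Local Notation C := R[i].

Definition cis (t : R) : C := cos t +i* sin t.

Lemma cisD s t : cis (s + t) = cis s * cis t.
Proof.
apply/eqP; rewrite eq_complex /= cosD sinD; apply/andP; split; apply/eqP; ring.
Qed.

Lemma cisX t n : cis t ^+ n = cis (n%:R * t).
Proof.
elim: n => [|n IH]; first by rewrite mul0r /cis cos0 sin0.
by rewrite exprS IH -cisD -natr1; congr cis; ring.
Qed.

Lemma norm_cis t : `|cis t| = 1.
Proof. by rewrite normc_def /= cos2Dsin2 sqrtr1. Qed.

Lemma cis_neq1 t : 0 < t -> t < pi *+ 2 -> cis t != 1.
Proof.
move=> t0 t2; apply/eqP => /eqP; rewrite eq_complex /= => /andP[/eqP c1 _].
have : cos t = cos (t / 2 *+ 2) by congr cos; rewrite mulr2n; field.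
rewrite c1 cos_mulr2n cos2sin2.
have : 0 < sin (t / 2) by apply: sin_gt0_pi; move: t2; rewrite mulr2n; lra.
move=> s0; have := exprn_gt0 2 s0; rewrite mulr2n; lra.
Qed.

(** A discrete Cauchy formula: averaging over the 2h-th roots of unity extracts coefficients exactly
    when the size is at most 2h, so no integral appears. *)
Lemma norm_coef_le (h : nat) (p : {poly C}) (r : R) j :
    (0 < h)%N -> 0 <= r -> (size p <= h.*2)%N -> (j < h.*2)%N ->
  `|p`_j| * (r ^+ j)%:C * h.*2%:R <=
  \sum_(i < h.*2) `|p.[r%:C * cis (pi * i%:R / h%:R)]|.
Proof.
move=> h0 r0 sp jh.
have hR : (h%:R : R) != 0 by rewrite pnatr_eq0 -lt0n.
pose x (i : nat) := cis (pi * i%:R / h%:R).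
have sum_geo (l : 'I_(h.*2)) : \sum_(i < h.*2) x i ^+ l * (x i ^+ j)^-1 =
    if l == j :> nat then h.*2%:R else 0.
  have x0 i : x i != 0 by rewrite -normr_eq0 norm_cis oner_eq0.
  case: eqP => [->|/eqP lj].
    rewrite (eq_bigr (fun=> 1)) => [|i _]; last by rewrite mulfV // expf_neq0.
    by rewrite sumr_const card_ord.
  have xE i : x i = x 1%N ^+ i by rewrite cisX; congr cis; rewrite mulr1; field.
  pose z := x 1%N ^+ l * (x 1%N ^+ j)^-1.
  rewrite (eq_bigr (fun i : 'I_(h.*2) => z ^+ i)) => [|i _]; last first.
    by rewrite xE /z exprMn exprVn -!exprM !(mulnC i).
  have zN : z ^+ h.*2 = 1.
    have xN : x 1%N ^+ h.*2 = 1.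
      rewrite cisX (_ : _ * _ = pi *+ 2); last first.
        by rewrite -muln2 natrM mulr2n; field.
      by rewrite /cis cos2pi sin2pi.
    by rewrite /z exprMn exprVn -!exprM !(mulnC _ h.*2) !exprM xN !expr1n invr1 mulr1.
  have z1 : z != 1.
    have neq a b : (a < b < h.*2)%N -> x 1%N ^+ a != x 1%N ^+ b.
      move=> /andP[ab bh]; rewrite -(subnK (ltnW ab)) exprD -[X in X != _]mul1r.
      rewrite (inj_eq (mulIf (expf_neq0 _ (x0 _)))) eq_sym cisX.
      apply: cis_neq1.
        by rewrite !mulr_gt0 ?invr_gt0 ?pi_gt0 ?ltr0n ?subn_gt0.
      have -> : (b - a)%:R * (pi * 1 / h%:R) = pi * ((b - a)%:R / h%:R) :> R.
        by ring.
      rewrite (_ : pi *+ 2 = pi * 2 :> R); last by rewrite mulr_natr.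
      rewrite ltr_pM2l ?pi_gt0 // ltr_pdivrMr ?ltr0n //.
      by rewrite -natrM mul2n ltr_nat (leq_ltn_trans (leq_subr _ _)).
    rewrite /z -(inj_eq (mulIf (expf_neq0 j (x0 1%N)))) mulfVK ?expf_neq0 // mul1r.
    move: lj; rewrite neq_ltn => /orP[lj|jl]; first by apply: neq; rewrite lj jh.
    by rewrite eq_sym; apply: neq; rewrite jl ltn_ord.
  have := subrX1 z h.*2; rewrite zN subrr => /esym/eqP.
  by rewrite mulf_eq0 subr_eq0 (negPf z1) => /eqP.
have -> : `|p`_j| * (r ^+ j)%:C * h.*2%:R =
    `|\sum_(i < h.*2) p.[r%:C * x i] * (x i ^+ j)^-1|.
  have -> : \sum_(i < h.*2) p.[r%:C * x i] * (x i ^+ j)^-1 =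
      p`_j * r%:C ^+ j * h.*2%:R.
    transitivity (\sum_(i < h.*2) \sum_(l < h.*2)
        p`_l * r%:C ^+ l * (x i ^+ l * (x i ^+ j)^-1)).
      apply: eq_bigr => i _; rewrite (horner_coef_wide _ sp) mulr_suml.
      by apply: eq_bigr => l _; rewrite exprMn !mulrA.
    rewrite exchange_big /=; under eq_bigr do rewrite -mulr_sumr sum_geo.
    rewrite (bigD1 (Ordinal jh)) //= eqxx big1 ?addr0 // => l lj.
    by rewrite -val_eqE /= in lj; rewrite (negPf lj) mulr0.
  rewrite !normrM normr_nat -rmorphXn [X in _ = _ * X * _]ger0_norm //.
  by rewrite ler0c exprn_ge0.
apply: le_trans (ler_norm_sum _ _ _) _; apply: ler_sum => i _.
by rewrite normrM normfV normrX norm_cis expr1n invr1 mulr1.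
Qed.

End CoefExtraction.

(** * Coefficients as averages over a circle *)

Section Krawtchouk.
Local Open Scope complex_scope.
Variable R : realType.
Local Notation C := R[i].

(** The generating function of the binary Krawtchouk polynomials: the coefficient of X^j is their
    value of degree j at the point k. *)
Definition krawtchouk (K : comNzRingType) (n k : nat) : {poly K} :=
  (1 + 'X) ^+ (n - k) * (1 - 'X) ^+ k.

Lemma map_krawtchouk (K L : comNzRingType) (f : {rmorphism K -> L}) n k :
  map_poly f (krawtchouk K n k) = krawtchouk L n k.
Proof.
rewrite /krawtchouk rmorphM !rmorphXn /= rmorphD rmorphB /= map_polyX.
by rewrite rmorph1.
Qed.

Lemma krawtchouk_monic (K : idomainType) n k : (k <= n)%N ->
  let p : {poly K} := ('X - (-1)%:P) ^+ (n - k) * ('X - 1%:P) ^+ k in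
  [/\ krawtchouk K n k = (-1) ^+ k *: p, p \is monic & size p = n.+1].
Proof.
move=> kn p; split.
- rewrite /krawtchouk (_ : 1 + 'X = 'X - (-1)%:P :> {poly K}); last first.
    by rewrite polyCN opprK polyC1 addrC.
  rewrite (_ : 1 - 'X = -1 *: ('X - 1%:P) :> {poly K}); last first.
    by rewrite scaleN1r opprB polyC1.
  by rewrite exprZn -scalerAr.
- by rewrite rpredM // rpredX // monicXsubC.
rewrite size_monicM ?rpredX ?monicXsubC //; last first.
  by rewrite -size_poly_gt0 size_exp_XsubC.
by rewrite !size_exp_XsubC addnS /= addSn subnK.
Qed.

Lemma size_krawtchouk (K : idomainType) n k : (k <= n)%N ->
  (size (krawtchouk K n k) <= n.+1)%N.
Proof.
move=> kn; have [-> _ <-] := krawtchouk_monic K kn.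
by rewrite size_scale_leq.
Qed.

Lemma krawtchouk_coef_ends (K : idomainType) n k : (k <= n)%N ->
  (krawtchouk K n k)`_0 = 1 /\ (krawtchouk K n k)`_n ^+ 2 = 1.
Proof.
move=> kn; split.
  by rewrite -horner_coef0 /krawtchouk !hornerE ?oppr0 ?addr0 ?expr1n ?mulr1.
have [-> /monicP lp sp] := krawtchouk_monic K kn.
by move: lp; rewrite lead_coefE sp /= coefZ => ->; rewrite mulr1 sqrr_sign.
Qed.

(** On the circle of radius r = sqrt(j / (n - j)), at angle pi i / h, the squared moduli of 1 + z
    and 1 - z are in the ratio p : 1 - p for this p. *)
Definition angle_prob (n j h i : nat) : R :=
  2^-1 + Num.sqrt (j%:R / n%:R) * Num.sqrt (1 - j%:R / n%:R) *
           cos (pi * i%:R / h%:R).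

Definition gauss_sum (n j k h : nat) : R := \sum_(i < h.*2)
  expR (- (n%:R / 2 * (angle_prob n j h i - (1 - k%:R / n%:R)) ^+ 2)).

Lemma norm_1DM_cis (r t : R) :
  `|1 + r%:C * cis t| = (Num.sqrt (1 + r ^+ 2 + 2 * r * cos t))%:C.
Proof.
rewrite normc_def /= !mul0r subr0 add0r addr0; congr (Num.sqrt _)%:C.
have := cos2Dsin2 t; move: (cos t) (sin t) => c s cs.
have -> : (1 + r * c) ^+ 2 + (r * s) ^+ 2 = 1 + r ^+ 2 * (c ^+ 2 + s ^+ 2) + 2 * r * c.
  by ring.
by rewrite cs mulr1.
Qed.

(** The saddle points are the roots of (n - j) z^2 - (n - 2k) z + j, with product j / (n - j): a
    conjugate pair lies on the circle of radius sqrt(j / (n - j)) whatever k is. On that circle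
    [binomial_gaussian_bound] applies pointwise. *)
Lemma krawtchouk_gauss_bound n j k (h := n.+1) : (j < n)%N -> (k <= n)%N ->
  'C(n, k)%:R * (krawtchouk R n k)`_j ^+ 2 * binomial_mode R n j * h.*2%:R ^+ 2
  <= 2 ^+ n * 'C(n, j)%:R * binomial_mode R n k * gauss_sum n j k h ^+ 2.
Proof.
move=> jn kn; have n0 : (0 < n)%N by exact: leq_ltn_trans jn.
have nR : 0 < n%:R :> R by rewrite ltr0n.
set io := j%:R / n%:R : R; set ka := k%:R / n%:R : R.
have i0 : 0 <= io by rewrite divr_ge0.
have i1 : 0 < 1 - io by rewrite subr_gt0 ltr_pdivrMr // mul1r ltr_nat.
have k0 : 0 <= ka by rewrite divr_ge0.
have k1 : 0 <= 1 - ka by rewrite subr_ge0 ler_pdivrMr // mul1r ler_nat.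
set x := Num.sqrt io; set y := Num.sqrt (1 - io).
have x2 : x ^+ 2 = io by rewrite sqr_sqrtr.
have y2 : y ^+ 2 = 1 - io by rewrite sqr_sqrtr // ltW.
have x0 : 0 <= x by rewrite sqrtr_ge0.
have y0 : 0 < y by rewrite sqrtr_gt0.
have xy : x * y <= 2^-1.
  have := sqr_ge0 (x - y); have -> : (x - y) ^+ 2 = x ^+ 2 + y ^+ 2 - 2 * (x * y) by ring.
  rewrite x2 y2; lra.
pose p i := angle_prob n j h i.
have p01 i : 0 <= p i /\ p i <= 1.
  rewrite /p /angle_prob -/io -/x -/y.
  have xy0 : 0 <= x * y by rewrite mulr_ge0 // ltW.
  have c1 := ler_wpM2l xy0 (cos_le1 (pi * i%:R / h%:R)).
  have c2 := ler_wpM2l xy0 (cos_geN1 (pi * i%:R / h%:R)).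
  rewrite mulr1 in c1; rewrite mulrN1 in c2.
  split.
    by apply: le_trans (_ : 2^-1 - x * y <= _); rewrite ?subr_ge0 ?lerD2l.
  by apply: le_trans (_ : 2^-1 + x * y <= _); rewrite ?lerD2l //; lra.
pose S := Num.sqrt (1 - ka) ^+ (n - k) * Num.sqrt ka ^+ k.
have := @norm_coef_le R h (krawtchouk C n k) (x / y) j (ltn0Sn _) (divr_ge0 x0 (ltW y0)) _ _.
have szk : (size (krawtchouk C n k) <= h.*2)%N.
  by apply: leq_trans (size_krawtchouk _ kn) _; rewrite -addnn leq_addr.
have jh : (j < h.*2)%N by rewrite -addnn; exact: leq_trans (leqW jn) (leq_addr _ _).
move=> /(_ szk jh).
have hornerE1 i : `|(krawtchouk C n k).[(x / y)%:C * cis (pi * i%:R / h%:R)]| =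
    ((Num.sqrt 2 / y) ^+ n * (Num.sqrt (p i) ^+ (n - k) * Num.sqrt (1 - p i) ^+ k))%:C.
  rewrite /krawtchouk hornerM !horner_exp !hornerD hornerN !hornerX !hornerC.
  rewrite normrM !normrX norm_1DM_cis.
  have -> : 1 - (x / y)%:C * cis (pi * i%:R / h%:R) =
      1 + (- (x / y))%:C * cis (pi * i%:R / h%:R) by rewrite rmorphN mulNr.
  rewrite norm_1DM_cis -!rmorphXn -rmorphM; congr _%:C.
  set c := cos _.
  have pE : p i = 2^-1 + x * y * c by [].
  have half q : 0 <= q -> Num.sqrt (2 * q / y ^+ 2) = Num.sqrt 2 / y * Num.sqrt q.
    move=> q0; rewrite sqrtrM ?mulr_ge0 // sqrtrV ?sqr_ge0 // sqrtr_sqr.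
    by rewrite (ger0_norm (ltW y0)) sqrtrM // mulrAC.
  have [pi0 pi1] := p01 i.
  have -> : 1 + (x / y) ^+ 2 + 2 * (x / y) * c = 2 * p i / y ^+ 2.
    rewrite pE; have -> : 1 + (x / y) ^+ 2 + 2 * (x / y) * c =
      (x ^+ 2 + y ^+ 2 + 2 * x * y * c) / y ^+ 2 by field; rewrite gt_eqF.
    by congr (_ / _); rewrite x2 y2; field.
  have -> : 1 + (- (x / y)) ^+ 2 + 2 * - (x / y) * c = 2 * (1 - p i) / y ^+ 2.
    rewrite pE; have -> : 1 + (- (x / y)) ^+ 2 + 2 * - (x / y) * c =
      (x ^+ 2 + y ^+ 2 - 2 * x * y * c) / y ^+ 2 by field; rewrite gt_eqF.
    by congr (_ / _); rewrite x2 y2; field.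
  rewrite !half ?subr_ge0 // !exprMn mulrACA -exprMn -exprMn -exprD subnK //.
  by rewrite exprMn.
rewrite (eq_bigr _ (fun (i : 'I_(h.*2)) _ => hornerE1 i)) -rmorph_sum.
rewrite -(map_krawtchouk (real_complex R)) coef_map /= normcE_norm.
rewrite -(rmorph_nat (real_complex R)) -!rmorphM lecR -mulr_sumr.
set a := ComplexField.Normc.normc _ => ha.
have a2 : a ^+ 2 = (krawtchouk R n k)`_j ^+ 2.
  by rewrite normc_sqr conjc_real -rmorphM.
have {ha} ha : a * (x / y) ^+ j * h.*2%:R <= (Num.sqrt 2 / y) ^+ n * (S * gauss_sum n j k h).
  apply: le_trans ha _; apply: ler_wpM2l.
    by rewrite exprn_ge0 // divr_ge0 ?sqrtr_ge0 // ltW.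
  rewrite mulr_sumr; apply: ler_sum => i _.
  by have [pi0 pi1] := p01 i; exact: binomial_gaussian_bound.
have a0 : 0 <= a by exact: normc_ge0.
have lhs0 : 0 <= a * (x / y) ^+ j * h.*2%:R.
  by rewrite !mulr_ge0 // exprn_ge0 // divr_ge0 // ltW.
have := lerXn2r 2 lhs0 (le_trans lhs0 ha) ha.
have -> : (a * (x / y) ^+ j * h.*2%:R) ^+ 2 =
    (krawtchouk R n k)`_j ^+ 2 * (io ^+ j * (1 - io) ^- j) * h.*2%:R ^+ 2.
  by rewrite 2!exprMn a2 exprAC expr_div_n x2 y2 expr_div_n.
have -> : ((Num.sqrt 2 / y) ^+ n * (S * gauss_sum n j k h)) ^+ 2 =
    2 ^+ n * (1 - io) ^- n * (ka ^+ k * (1 - ka) ^+ (n - k)) * gauss_sum n j k h ^+ 2.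
  rewrite exprMn exprAC expr_div_n y2 sqr_sqrtr // expr_div_n exprMn /S exprMn.
  rewrite ![(Num.sqrt _ ^+ _) ^+ 2]exprAC !sqr_sqrtr // (mulrC (ka ^+ k)).
  by rewrite !mulrA.
move=> hsq; rewrite /binomial_mode -/io -/ka.
(* This factor completes the powers on the left to [binomial_mode] at j and those on the right to
   [binomial_mode] at k. *)
have cc : 0 <= 'C(n, k)%:R * 'C(n, j)%:R * (1 - io) ^+ n.
  by rewrite !mulr_ge0 // exprn_ge0 // ltW.
have := ler_wpM2l cc hsq.
have en : (1 - io) ^+ n = (1 - io) ^+ (n - j) * (1 - io) ^+ j.
  by rewrite -exprD subnK // ltnW.
have u0 e : (1 - io) ^+ e != 0 by rewrite expf_neq0 // gt_eqF.
congr (_ <= _).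
  rewrite en; move: (u0 j).
  move: ((1 - io) ^+ j) ((1 - io) ^+ (n - j)) (io ^+ j) ((krawtchouk R n k)`_j) => *.
  by field.
move: (u0 n); move: ((1 - io) ^+ n) (ka ^+ k) ((1 - ka) ^+ (n - k)) (gauss_sum _ _ _ _) => *.
by field.
Qed.

End Krawtchouk.

(** * The uniform coefficient bound *)

Section KrawtchoukBound.
Variable R : realType.

Lemma sum_fold_cos (g : R -> R) (h : nat) : (0 < h)%N -> (forall t, 0 <= g t) ->
  \sum_(i < h.*2) g (cos (pi * i%:R / h%:R)) <=
  2 * \sum_(i < h.+1) g (cos (pi * i%:R / h%:R)).
Proof.
move=> h0 g0; have hR : (h%:R : R) != 0 by rewrite pnatr_eq0 -lt0n.
pose F i := g (cos (pi * i%:R / h%:R)).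
rewrite -(big_mkord xpredT F) -[in leRHS](big_mkord xpredT F) mulr2n mulrDl !mul1r.
have hh : (h <= h.*2)%N by rewrite -addnn leq_addr.
rewrite (big_cat_nat (n := h)) //=; apply: lerD.
  rewrite [leRHS](big_cat_nat (n := h)) //= lerDl; apply: sumr_ge0 => i _.
  exact: g0.
rewrite big_nat_rev /= -{1}(add0n h) big_addn -addnn addnK.
rewrite [leRHS]big_nat_recl // ler_wpDl //; first exact: g0.
rewrite !big_nat; apply: ler_sum => i /andP[_ ih].
rewrite le_eqVlt; apply/orP; left; apply/eqP; congr (g _).
have -> : (h + (h + h) - (i + h).+1)%N = (h + h - i.+1)%N by lia.
rewrite natrB; last by lia.
have -> : pi * ((h + h)%:R - i.+1%:R) / h%:R = - (pi * i.+1%:R / h%:R) + pi *+ 2 :> R.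
  by rewrite natrD mulr2n; field.
by rewrite cosD2pi cosN.
Qed.

Lemma gauss_sum_triv n j k h : gauss_sum R n j k h <= h.*2%:R.
Proof.
apply: le_trans (_ : \sum_(i < h.*2) 1 <= _); last by rewrite sumr_const card_ord.
apply: ler_sum => i _; rewrite -expR0 ler_expR oppr_le0.
by rewrite mulr_ge0 ?sqr_ge0 // divr_ge0.
Qed.

Lemma gauss_sum_ge0 n j k h : 0 <= gauss_sum R n j k h.
Proof. by apply: sumr_ge0 => i _; exact: expR_ge0. Qed.

(** In terms of the cosine the exponent is M (cos - c)^2 with M = j (n - j) / (2 n), and
    [gauss_cos_sum] is uniform in c. The last factor on the right is comparable to [binomial_mode]
    at j and will cancel against it. *)
Lemma gauss_sum_oscillating n j k (h := n.+1) : (0 < j < n)%N ->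
  gauss_sum R n j k h ^+ 2 <= 2 * (64 * h%:R) ^+ 2 * Num.sqrt (n%:R / (j%:R * (n - j)%:R)).
Proof.
move=> /andP[j0 jn]; have n0 : (0 < n)%N by exact: leq_ltn_trans jn.
have nR : 0 < n%:R :> R by rewrite ltr0n.
set io := j%:R / n%:R : R.
have i0 : 0 < io by rewrite divr_gt0 // ltr0n.
have i1 : 0 < 1 - io by rewrite subr_gt0 ltr_pdivrMr // mul1r ltr_nat.
set x := Num.sqrt io; set y := Num.sqrt (1 - io).
have xy0 : 0 < x * y by rewrite mulr_gt0 // sqrtr_gt0.
have xy2 : (x * y) ^+ 2 = io * (1 - io) by rewrite exprMn !sqr_sqrtr // ltW.
pose M := n%:R / 2 * (x * y) ^+ 2.
have M0 : 0 < M by rewrite mulr_gt0 ?exprn_gt0 // divr_gt0.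
have nh : n%:R <= h%:R :> R by rewrite ler_nat.
have h1 : 1 <= h%:R :> R by rewrite ler1n.
have Mh : M <= h%:R ^+ 4.
  apply: le_trans (_ : h%:R <= _); last by rewrite -[leLHS]expr1 ler_weXn2l.
  apply: le_trans nh; rewrite /M xy2 -[leRHS]mulr1 -mulrA ler_pM2l //; nra.
pose c := (2^-1 - k%:R / n%:R) / (x * y).
have := gauss_cos_sum c (ltn0Sn n : (0 < h)%N) M0 Mh.
have := @sum_fold_cos (fun u => expR (- (M * (u - c) ^+ 2))) h (ltn0Sn n) (fun=> expR_ge0 _).
set B := 32 * h%:R / _ => fold bound.
have E : gauss_sum R n j k h =
    \sum_(i < h.*2) expR (- (M * (cos (pi * i%:R / h%:R) - c) ^+ 2)).
  apply: eq_bigr => i _; congr (expR (- _)).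
  rewrite /M /angle_prob -/io -/x -/y /c; move: (cos _) (x * y) xy0 => u v v0.
  by field; lra.
have {fold bound} gB : gauss_sum R n j k h <= 2 * B.
  by rewrite E; apply: le_trans fold _; rewrite ler_pM2l.
have := lerXn2r 2 (gauss_sum_ge0 n j k h) (le_trans (gauss_sum_ge0 _ _ _ _) gB) gB.
move/le_trans; apply.
have sM : 0 < Num.sqrt M by rewrite sqrtr_gt0.
have -> : (2 * B) ^+ 2 = (64 * h%:R) ^+ 2 / Num.sqrt M.
  rewrite /B -[in RHS](sqr_sqrtr (ltW sM)).
  by field; rewrite gt_eqF // sqrtr_gt0.
rewrite -mulrA mulrCA ler_wpM2l ?sqr_ge0 //.
set v := Num.sqrt (_ / _).
have vM : v * Num.sqrt M * 2 >= 1.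
  have ME : n%:R / (j%:R * (n - j)%:R) * M = 2^-1.
    rewrite /M xy2 /io natrB ?(ltnW jn) //.
    have a0 : j%:R != 0 :> R by rewrite pnatr_eq0 -lt0n.
    have a1 : n%:R - j%:R != 0 :> R by rewrite subr_eq0 eqr_nat gtn_eqF.
    by field; rewrite a0 a1 gt_eqF.
  rewrite -sqrtrM ?divr_ge0 ?mulr_ge0 // ME.
  have : (2^-1) ^+ 2 <= (2^-1 : R) by lra.
  by rewrite -ler_sqrt // sqrtr_sqr ger0_norm //; lra.
by rewrite -[leLHS]mul1r ler_pdivrMr //; lra.
Qed.

(** The cosine term is at most 3/10 in modulus, so p stays in [1/5, 4/5], while 1 - k/n is at most
    1/10 or at least 9/10. The gap of 1/10 gives the exponent (n/2) / 100. *)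
Lemma gauss_sum_forbidden n j k h : (0 < n)%N -> (j <= n)%N ->
    4 / 5 <= `|1 - 2 * (j%:R / n%:R) : R| -> 4 / 5 <= `|1 - 2 * (k%:R / n%:R) : R| ->
  gauss_sum R n j k h <= h.*2%:R * expR (- (n%:R / 200)).
Proof.
move=> n0 jn hj hk; have nR : 0 < n%:R :> R by rewrite ltr0n.
rewrite mulr_natl -[in leRHS](card_ord h.*2) -sumr_const; apply: ler_sum => i _.
rewrite ler_expR lerN2 /angle_prob.
set io := j%:R / n%:R : R in hj *; set ka := k%:R / n%:R in hk *.
have i0 : 0 <= io by rewrite divr_ge0.
have i1 : 0 <= 1 - io by rewrite subr_ge0 ler_pdivrMr // mul1r ler_nat.
set c := cos _; set z := Num.sqrt io * Num.sqrt (1 - io).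
have z0 : 0 <= z by rewrite mulr_ge0 ?sqrtr_ge0.
have zz : z ^+ 2 = io * (1 - io) by rewrite exprMn !sqr_sqrtr.
have z3 : z <= 3 / 10.
  rewrite -(@ler_pXn2r _ 2) ?nnegrE // zz.
  have : (4 / 5) ^+ 2 <= (1 - 2 * io) ^+ 2.
    by rewrite -(real_normK (num_real (1 - _))) ler_sqr ?nnegrE //; lra.
  rewrite !expr2; lra.
have zc : `|z * c| <= 3 / 10.
  rewrite normrM (ger0_norm z0) -[leRHS]mulr1; apply: ler_pM => //.
  exact: cos_max.
have : (100^-1 : R) <= (2^-1 + z * c - (1 - ka)) ^+ 2.
  have sq (t : R) : 10^-1 <= `|t| -> 100^-1 <= t ^+ 2.
    move=> ht; have : 10^-1 ^+ 2 <= t ^+ 2.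
      by rewrite -(real_normK (num_real t)) ler_sqr ?nnegrE //; lra.
    by rewrite expr2; lra.
  apply: sq; rewrite ler_normr; move: hk zc; rewrite ler_normr ler_norml.
  move: (z * c) => u /orP[hk|hk] /andP[u1 u2]; apply/orP; [right|left]; lra.
move=> h3; have -> : n%:R / 200 = n%:R / 2 * 100^-1 :> R by field.
by rewrite ler_wpM2l // divr_ge0.
Qed.

(** Here k/n lies between 1/10 and 9/10, so k (n - k) >= 9 n^2 / 100 >= n^2 / 16. *)
Lemma mode_central n k : (0 < n)%N -> (k <= n)%N ->
    `|1 - 2 * (k%:R / n%:R) : R| <= 4 / 5 ->
  binomial_mode R n k <= expR (5 / 2) * 4 / Num.sqrt n%:R.
Proof.
move=> n0 kn hk; have nR : 0 < n%:R :> R by rewrite ltr0n.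
set ka := k%:R / n%:R in hk; move: hk; rewrite ler_norml => /andP[k1 k2].
have kka : k%:R = n%:R * ka by rewrite /ka; field; rewrite gt_eqF.
have k0 : (0 < k)%N by rewrite -(ltr0n R) kka mulr_gt0 //; lra.
have kn' : (k < n)%N by rewrite -(ltr_nat R) kka -[ltRHS]mulr1 ltr_pM2l //; lra.
have [_] := @binomial_mode_bounds R n k (introT andP (conj k0 kn')).
move/le_trans; apply; rewrite -mulrA ler_pM2l ?expR_gt0 //.
have -> : 4 / Num.sqrt n%:R = Num.sqrt (16 / n%:R) :> R.
  rewrite sqrtrM // sqrtrV //; congr (_ / _).
  have -> : (16 : R) = 4 ^+ 2 by rewrite expr2; ring.
  by rewrite sqrtr_sqr ger0_norm.
rewrite ler_sqrt ?divr_ge0 // natrB // kka ler_pdivrMr; last first.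
  apply: mulr_gt0; first by apply: mulr_gt0 => //; lra.
  by rewrite -{1}[n%:R]mulr1 -mulrBr; apply: mulr_gt0 => //; lra.
rewrite mulrAC ler_pdivlMr //.
have -> : 16 * (n%:R * ka * (n%:R - n%:R * ka)) = n%:R * n%:R * (16 * (ka * (1 - ka))) by ring.
rewrite ler_peMr ?mulr_ge0 //; nra.
Qed.

Lemma mode_lower n j : (0 < n)%N -> (j < n)%N ->
  1 <= binomial_mode R n j * (expR (5 / 2) * Num.sqrt n%:R).
Proof.
move=> n0 jn; have nR : 0 < n%:R :> R by rewrite ltr0n.
have D1 : 1 <= expR (5 / 2) :> R by have := expR_ge1Dx (5 / 2 : R); lra.
have n1 : 1 <= Num.sqrt n%:R :> R by rewrite -[leLHS]sqrtr1 ler_sqrt ?ler1n.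
have [->|j0] := posnP j.
  rewrite /binomial_mode bin0 mul0r subr0 expr1n !mul1r.
  by rewrite -[leLHS]mulr1; apply: ler_pM.
have [+ _] := @binomial_mode_bounds R n j (introT andP (conj j0 jn)).
set v := Num.sqrt _ => hv.
have v1 : 1 <= v * Num.sqrt n%:R.
  rewrite -sqrtrM ?divr_ge0 ?mulr_ge0 // -[leLHS]sqrtr1 ler_sqrt ?divr_ge0 ?mulr_ge0 //.
  have jR : 0 < j%:R * (n - j)%:R :> R by rewrite mulr_gt0 ?ltr0n ?subn_gt0.
  rewrite mulrAC ler_pdivlMr // mul1r; apply: ler_pM => //.
    by rewrite ler_nat ltnW.
  by rewrite ler_nat leq_subr.
rewrite ler_pdivrMr // in hv.
apply: le_trans v1 _; rewrite mulrA; apply: ler_wpM2r hv; exact: sqrtr_ge0.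
Qed.

Lemma krawtchouk_coef_end_eq n k : (k <= n)%N ->
  (krawtchouk R n k)`_n ^+ 2 = (krawtchouk R n k)`_0 ^+ 2.
Proof. by move=> /(krawtchouk_coef_ends R)[-> ->]; rewrite expr1n. Qed.

(** The oscillating case dictates 100, through 8 * 64^2 <= 4 * 100^2; the exponential enters twice,
    from the bounds on the masses at j and at k. *)
Definition krawtchouk_const : R := (100 * expR (5 / 2)) ^+ 2.

(** If k is central, its mass supplies n^(-1/2) and the Gaussian sum cancels against the mass at j;
    at j = 0 that mass is 1 and the trivial bound on the sum is enough. If k is outer, the last
    hypothesis makes j outer as well, and the exponentially small sum wins. *)
Lemma krawtchouk_bound_lt n j k : (0 < n)%N -> (j < n)%N -> (k <= n)%N ->
    `|1 - 2 * (k%:R / n%:R) : R| <= `|1 - 2 * (j%:R / n%:R) : R| ->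
  'C(n, k)%:R * (krawtchouk R n k)`_j ^+ 2 <=
  krawtchouk_const / Num.sqrt n%:R * (2 ^+ n * 'C(n, j)%:R).
Proof.
move=> n0 jn kn kj; have nR : 0 < n%:R :> R by rewrite ltr0n.
pose h := n.+1; have h0 : 0 < h.*2%:R :> R by rewrite ltr0n double_gt0.
have := krawtchouk_gauss_bound R jn kn; rewrite -/h.
set G := gauss_sum R n j k h; set N := 2 ^+ n * 'C(n, j)%:R.
set A := 'C(n, k)%:R * (krawtchouk R n k)`_j ^+ 2; set bj := binomial_mode R n j; set bk := binomial_mode R n k.
move=> main; set s := Num.sqrt n%:R.
have s0 : 0 < s by rewrite sqrtr_gt0.
have ss : s ^+ 2 = n%:R by rewrite sqr_sqrtr // ltW.
pose D : R := expR (5 / 2); have D1 : 1 <= D by have := expR_ge1Dx (5 / 2 : R); rewrite -/D; lra.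
have low : 1 <= bj * (D * s) by exact: mode_lower.
have N0 : 0 < N by rewrite mulr_gt0 ?exprn_gt0 // ltr0n bin_gt0 ltnW.
have G0 : 0 <= G by exact: gauss_sum_ge0.
have bk0 : 0 <= bk.
  rewrite mulr_ge0 ?mulr_ge0 ?exprn_ge0 ?divr_ge0 // subr_ge0.
  by rewrite ler_pdivrMr // mul1r ler_nat.
have bj0 : 0 < bj.
  have Ds0 : 0 < D * s by rewrite mulr_gt0 // expR_gt0.
  by rewrite -(pmulr_lgt0 _ Ds0); exact: lt_le_trans ltr01 low.
have reduce (e : R) : bk * G ^+ 2 <= e * (bj * h.*2%:R ^+ 2) -> A <= e * N.
  move=> He.
  have w0 : 0 < bj * h.*2%:R ^+ 2 by rewrite mulr_gt0 // exprn_gt0.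
  rewrite -(ler_pM2r w0) [leLHS]mulrA; apply: le_trans main _.
  rewrite -mulrA; apply: le_trans (ler_wpM2l (ltW N0) He) _.
  by rewrite mulrCA mulrA.
apply: reduce; rewrite /krawtchouk_const -/D.
have [central|/ltW outer] := leP `|1 - 2 * (k%:R / n%:R) : R| (4 / 5).
  have bkc : bk <= D * 4 / s by exact: mode_central.
  have [j0|j0] := posnP j.
    have -> : bj = 1.
      by rewrite /bj j0 /binomial_mode bin0 mul0r subr0 expr1n !mul1r.
    rewrite mul1r; apply: ler_pM => //; first exact: sqr_ge0.
      apply: le_trans bkc _; rewrite ler_pM2r ?invr_gt0 //; nra.
    rewrite ler_sqr ?nnegrE ?(ltW h0) //; exact: gauss_sum_triv.
  have := @gauss_sum_oscillating n j k (introT andP (conj j0 jn)).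
  have [+ _] := @binomial_mode_bounds R n j (introT andP (conj j0 jn)).
  rewrite -/G -/bj -/D; set v := Num.sqrt (_ / _) => hv osc.
  rewrite ler_pdivrMr in hv; last by lra.
  apply: le_trans (ler_pM bk0 (sqr_ge0 G) bkc osc) _.
  have -> : h.*2%:R = 2 * h%:R :> R by rewrite -mul2n natrM.
  have hs : 0 <= D * 4 / s * (2 * (64 * h%:R) ^+ 2).
    by rewrite mulr_ge0 ?divr_ge0 ?mulr_ge0 ?exprn_ge0 //; lra.
  rewrite [leLHS]mulrA; apply: le_trans (ler_wpM2l hs hv) _.
  have -> : D * 4 / s * (2 * (64 * h%:R) ^+ 2) * (bj * D) =
      (D ^+ 2 / s * (bj * h%:R ^+ 2)) * (8 * 64 ^+ 2) by ring.
  have -> : (100 * D) ^+ 2 / s * (bj * (2 * h%:R) ^+ 2) =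
      (D ^+ 2 / s * (bj * h%:R ^+ 2)) * (4 * 100 ^+ 2) by ring.
  apply: ler_wpM2l; last by lra.
  apply: mulr_ge0; first by rewrite divr_ge0 ?sqr_ge0 ?(ltW s0).
  by apply: mulr_ge0; [exact: ltW|exact: sqr_ge0].
have forb := gauss_sum_forbidden h n0 (ltnW jn) (le_trans outer kj) outer.
have bk1 : bk <= 1 by exact: binomial_mode_le1.
(* The exponential decay is spent on exp(-n/100) <= 100/n: one factor n^(-1/2) pays for the lower
   bound on the mass at j, the other is the gain. *)
have G2 : G ^+ 2 <= h.*2%:R ^+ 2 * (100 / s ^+ 2).
  apply: le_trans (lerXn2r 2 G0 _ forb) _.
    by rewrite nnegrE mulr_ge0 ?expR_ge0 ?(ltW h0).
  rewrite exprMn; apply: ler_wpM2l; first exact: sqr_ge0.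
  rewrite expr2 -expRD.
  have -> : - (n%:R / 200) + - (n%:R / 200) = - (n%:R / 100) :> R by field.
  apply: le_trans (expRN_le_inv _) _; first by rewrite divr_ge0.
  have -> : 100 / s ^+ 2 = (n%:R / 100)^-1 by rewrite ss; field; rewrite gt_eqF.
  by rewrite lef_pV2 ?posrE; [lra|rewrite addr_gt0 // divr_gt0|rewrite divr_gt0].
apply: le_trans (ler_pM bk0 (sqr_ge0 G) bk1 G2) _.
rewrite mul1r mulrC -[leRHS]mulrA.
have -> : (100 * D) ^+ 2 * (s^-1 * (bj * h.*2%:R ^+ 2)) =
    (100 ^+ 2 * D / s ^+ 2 * (bj * (D * s))) * h.*2%:R ^+ 2.
  by field; rewrite gt_eqF.
apply: ler_wpM2r; first exact: sqr_ge0.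
apply: le_trans (_ : 100 ^+ 2 * D / s ^+ 2 * 1 <= _); last first.
  apply: ler_wpM2l low; apply: divr_ge0; last exact: sqr_ge0.
  by apply: mulr_ge0; [exact: sqr_ge0|exact: le_trans ler01 D1].
rewrite mulr1; apply: ler_wpM2r; first by rewrite invr_ge0 sqr_ge0.
by rewrite expr2; lra.
Qed.

(** At j = n the radius would be infinite; the coefficient there has the same square as the one at
    0, which replaces it. *)
Lemma krawtchouk_bound n j k : (0 < n)%N -> (j <= n)%N -> (k <= n)%N ->
    `|1 - 2 * (k%:R / n%:R) : R| <= `|1 - 2 * (j%:R / n%:R) : R| ->
  'C(n, k)%:R * (krawtchouk R n k)`_j ^+ 2 <=
  krawtchouk_const / Num.sqrt n%:R * (2 ^+ n * 'C(n, j)%:R).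
Proof.
move=> n0; rewrite leq_eqVlt => /orP[/eqP ->|jn] kn kj; last exact: krawtchouk_bound_lt.
have -> : 'C(n, n) = 'C(n, 0) by rewrite binn bin0.
rewrite krawtchouk_coef_end_eq //; apply: krawtchouk_bound_lt => //.
apply: le_trans kj _; rewrite mul0r mulr0 subr0 normr1 divff ?pnatr_eq0 -?lt0n //.
by rewrite (_ : 1 - 2 * 1 = -1) ?normrN1 //; ring.
Qed.

End KrawtchoukBound.

(** * The three-term recurrence *)

Section KrawtchoukRecurrence.
Variable K : numFieldType.

Lemma ode_identity (A : comPzRingType) (z u v x y : A) :
  (1 - z) * v * (u * x) + (1 + z) * u * (- v * y) + z * (u * v) * (x + y) =
  u * v * (x + y) - u * v * (2 * y).
Proof. ring. Qed.

(** The logarithmic derivative of p is (n - k) / (1 + X) - k / (1 - X); clearing denominators gives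
    a first-order equation whose coefficients are the recurrence of the ladder. *)
Lemma krawtchouk_ode n k : (k <= n)%N ->
  let p := krawtchouk K n k in
  (1 - 'X ^+ 2) * p^`() + 'X * p *+ n = p *+ n - p *+ (2 * k).
Proof.
move=> kn p; rewrite /p /krawtchouk; set a := (n - k)%N.
have na : n = (a + k)%N by rewrite subnK.
have dE (q : {poly K}) m : q * (q ^+ m)^`() = q^`() * q ^+ m *+ m.
  rewrite deriv_exp -mulrnAr mulrCA; case: m => [|m]; first by rewrite !mulr0n !mulr0.
  by rewrite /= mulrnAr -exprS -mulrnAr.
have d1 := dE (1 + 'X) a; have d2 := dE (1 - 'X) k.
have e1 : (1 + 'X)^`() = 1 :> {poly K} by rewrite derivD derivX derivC add0r.
have e2 : (1 - 'X)^`() = -1 :> {poly K} by rewrite derivB derivX derivC sub0r.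
rewrite e1 mul1r in d1; rewrite e2 mulN1r in d2.
rewrite derivM mulrDr.
have -> : (1 - 'X ^+ 2) * (((1 + 'X) ^+ a)^`() * (1 - 'X) ^+ k) =
    (1 - 'X) * (1 - 'X) ^+ k * ((1 + 'X) * ((1 + 'X) ^+ a)^`()) :> {poly K} by ring.
have -> : (1 - 'X ^+ 2) * ((1 + 'X) ^+ a * ((1 - 'X) ^+ k)^`()) =
    (1 + 'X) * (1 + 'X) ^+ a * ((1 - 'X) * ((1 - 'X) ^+ k)^`()) :> {poly K} by ring.
rewrite d1 d2 na; move: ((1 + 'X) ^+ a) ((1 - 'X) ^+ k) => u v.
rewrite -(mulr_natr u a) -(mulr_natr (- v) k) -(mulr_natr ('X * (u * v)) _).
by rewrite -!(mulr_natr (u * v) _) natrD natrM ode_identity.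
Qed.

Lemma krawtchouk_rec0 n k : (k <= n)%N ->
  (krawtchouk K n k)`_1 = (n%:R - 2 * k%:R) * (krawtchouk K n k)`_0.
Proof.
move=> kn; have := congr1 (fun p : {poly K} => p`_0) (krawtchouk_ode kn).
rewrite mulrBl mul1r -mulrnAr coefD coefB !coefXM !coefXnM /= subr0 addr0.
rewrite coefB !coefMn coef_deriv mulr1n => ->.
by rewrite -!(mulr_natr (krawtchouk K n k)`_0 _) natrM; ring.
Qed.

Lemma krawtchouk_rec n k j : (k <= n)%N ->
  (n%:R - 2 * k%:R) * (krawtchouk K n k)`_j.+1 =
  j.+2%:R * (krawtchouk K n k)`_j.+2 + (n%:R - j%:R) * (krawtchouk K n k)`_j.
Proof.
move=> kn; have := congr1 (fun p : {poly K} => p`_j.+1) (krawtchouk_ode kn).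
rewrite mulrBl mul1r -mulrnAr coefD coefB !coefXM !coefXnM /= coefB !coefMn.
have -> : (n%:R - 2 * k%:R) * (krawtchouk K n k)`_j.+1 =
    (krawtchouk K n k)`_j.+1 *+ n - (krawtchouk K n k)`_j.+1 *+ (2 * k).
  by rewrite -!(mulr_natr (krawtchouk K n k)`_j.+1 _) natrM; ring.
move=> <-; rewrite coef_deriv.
rewrite -(mulr_natr (krawtchouk K n k)`_j.+2) -(mulr_natr (krawtchouk K n k)`_j).
case: j => [|j] /=; first by ring.
rewrite subn2 /= coef_deriv -(mulr_natr (krawtchouk K n k)`_j.+1); ring.
Qed.

Lemma krawtchouk_coef_unique n k (y : nat -> K) : (k <= n)%N ->
    y 1%N = (n%:R - 2 * k%:R) * y 0%N ->
    (forall j, (n%:R - 2 * k%:R) * y j.+1 = j.+2%:R * y j.+2 + (n%:R - j%:R) * y j) ->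
  forall j, y j = y 0%N * (krawtchouk K n k)`_j.
Proof.
move=> kn y1 yrec.
have [K0 _] := krawtchouk_coef_ends K kn.
suff H j : y j = y 0%N * (krawtchouk K n k)`_j /\
           y j.+1 = y 0%N * (krawtchouk K n k)`_j.+1 by move=> j; have [] := H j.
elim: j => [|j [IH0 IH1]].
  by rewrite K0 mulr1 krawtchouk_rec0 // K0 mulr1 y1 mulrC.
split=> //; apply: (mulfI (_ : j.+2%:R != 0)); first by rewrite pnatr_eq0.
have := yrec j; have := krawtchouk_rec j kn; rewrite IH0 IH1.
move: (krawtchouk K n k)`_j (krawtchouk K n k)`_j.+1 (krawtchouk K n k)`_j.+2 => a b c h1 h2.
have -> : j.+2%:R * y j.+2 = (n%:R - 2 * k%:R) * (y 0%N * b) - (n%:R - j%:R) * (y 0%N * a).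
  by rewrite h2 addrK.
have -> : j.+2%:R * (y 0%N * c) = y 0%N * (j.+2%:R * c) by ring.
have -> : j.+2%:R * c = (n%:R - 2 * k%:R) * b - (n%:R - j%:R) * a by rewrite h1 addrK.
ring.
Qed.

Lemma krawtchouk_0 n j : (krawtchouk K n 0)`_j = 'C(n, j)%:R.
Proof.
rewrite /krawtchouk subn0 expr0 mulr1 exprDn coef_sum.
have [jn|nj] := leqP j n; last first.
  rewrite bin_small // big1 // => i _; rewrite expr1n mul1r coefMn coefXn.
  by rewrite gtn_eqF ?mul0rn // (leq_ltn_trans _ nj) // -ltnS.
rewrite (bigD1 (Ordinal (jn : (j < n.+1)%N))) //= big1 => [|i ij].
  by rewrite expr1n mul1r addr0 coefMn coefXn eqxx.
rewrite expr1n mul1r coefMn coefXn; rewrite -val_eqE /= in ij.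
by rewrite eq_sym (negPf ij) mul0rn.
Qed.

End KrawtchoukRecurrence.

(** * Overlaps of the two ladders *)

Section SpinBases.
Local Open Scope sesquilinear_scope.
Local Open Scope complex_scope.
Variable R : realType.
Local Notation C := R[i].
Local Notation normc := ComplexField.Normc.normc.
Local Notation "''[' u , v ]" := (dotmx u v) : ring_scope.
Local Notation "''[' u ]" := '[u, u]%R : ring_scope.

Definition ladder n (A B : 'M[C]_n.+1) (e : nat -> 'rV[C]_n.+1) : Prop :=
  [/\ forall j, e j *m A = (n%:R / 2 - j%:R)%:C *: e j,
      2 *: (e 0%N *m B) = e 1%N,
      forall j, 2 *: (e j.+1 *m B) =
        j.+2%:R *: e j.+2 + (n%:R - j%:R) *: e j,
      forall j, '[e j] = 'C(n, j)%:R &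
      forall i j, i != j -> '[e i, e j] = 0].

Lemma dotmxDl n (u v w : 'rV[C]_n) : '[u + v, w] = '[u, w] + '[v, w].
Proof. by rewrite !dotmxE mulmxDl mxE. Qed.

Lemma dotmx_conj n (u v : 'rV[C]_n) : '[u, v] = conjc '[v, u].
Proof.
rewrite !dotmxE !mxE rmorph_sum; apply: eq_bigr => i _.
by rewrite rmorphM !mxE mulrC; congr (_ * _); exact: esym (conjcK _).
Qed.

Lemma normc_conj (z : C) : normc (conjc z) = normc z.
Proof. by apply: complexI; rewrite -!normcE_norm normcJ. Qed.

Lemma normcM (x y : C) : normc (x * y) = normc x * normc y.
Proof. exact: ComplexField.Normc.normcM. Qed.

Lemma sqr_norm_real (x : R) : `|x%:C| ^+ 2 = (x ^+ 2)%:C.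
Proof.
by rewrite normcE_norm -rmorphXn normc_sqr conjc_real -rmorphM /= expr2.
Qed.

Lemma normc_natr m : normc (m%:R : C) = m%:R.
Proof. by rewrite -(rmorph_nat (real_complex R)) normc_real. Qed.

Lemma sum_normc_unit d (U : 'M[C]_d) i : U \is unitarymx ->
  \sum_j normc (U i j) ^+ 2 = 1.
Proof.
move=> Uu; apply: complexI; rewrite rmorph_sum -[RHS](row_unitary i Uu) dotmx_sum.
by apply: eq_bigr => j _; rewrite mxE normcE_norm rmorphXn.
Qed.

Definition overlap_sq n (e f : nat -> 'rV[C]_n) (j k : nat) : R :=
  normc '[e j, f k] ^+ 2.

Lemma overlap_sq_quotient (x y : R) : y != 0 -> x * y ^+ 2 / (1%:R * y) = x * y.
Proof. by move=> y0; field. Qed.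

Section Overlaps.
Variables (n : nat) (A B : 'M[C]_n.+1) (e f : nat -> 'rV[C]_n.+1).
Hypotheses (Ah : A^t* = A) (Bh : B^t* = B).
Hypotheses (eL : ladder A B e) (fL : ladder B A f).

(** Self-adjointness moves [B] onto its eigenvector [u], where it is a scalar, so the action of 2B
    on the ladder becomes the coefficient recurrence for the inner products. *)
Lemma ladder_overlap_rec (u : 'rV[C]_n.+1) k j : (k <= n)%N ->
    u *m B = (n%:R / 2 - k%:R)%:C *: u ->
  '[e j, u] = '[e 0%N, u] * (krawtchouk C n k)`_j.
Proof.
move=> kn uB; have [_ e1 eS _ _] := eL.
have two v : '[2 *: (v *m B), u] = (n%:R - 2 * k%:R) * '[v, u].
  rewrite dotmxZl dotmxMl Bh uB dotmxZr mulrA; congr (_ * _).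
  rewrite [X in _ * X](conjc_real (n%:R / 2 - k%:R)).
  rewrite -(rmorph_nat (real_complex R) n) -(rmorph_nat (real_complex R) k).
  rewrite -(rmorph_nat (real_complex R) 2) -!rmorphM -rmorphB; congr _%:C.
  by field.
apply: (@krawtchouk_coef_unique _ n k (fun j => '[e j, u])) => //.
  by rewrite -e1 two.
by move=> i; rewrite -two eS dotmxDl !dotmxZl.
Qed.

Definition normalized (h : nat -> 'rV[C]_n.+1) : 'M[C]_n.+1 :=
  \matrix_(j < n.+1) ((Num.sqrt 'C(n, j)%:R)^-1%:C *: h j).

Lemma sqrt_bin_gt0 j : (j <= n)%N -> 0 < Num.sqrt 'C(n, j)%:R :> R.
Proof. by move=> jn; rewrite sqrtr_gt0 ltr0n bin_gt0. Qed.

Lemma normalized_unitary (D D' : 'M[C]_n.+1) h : ladder D D' h ->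
  normalized h \is unitarymx.
Proof.
move=> [_ _ _ hn ho]; apply/row_unitarymxP => i j; rewrite !rowK dotmxZl dotmxZr.
have [->|ij] := eqVneq i j; last by rewrite ho // !mulr0.
rewrite hn [X in _ * (X * _)](conjc_real) -(rmorph_nat (real_complex R)) -!rmorphM.
have s0 := sqrt_bin_gt0 (ltn_ord j : (j <= n)%N).
rewrite -[X in _ * (_ * X)](sqr_sqrtr (ler0n R _)) (_ : _ * _ = 1) //.
by field; rewrite gt_eqF.
Qed.

Lemma normalized_overlap (h h' : nat -> 'rV[C]_n.+1) (j k : 'I_n.+1) :
  normc ((normalized h *m (normalized h')^t*) j k) ^+ 2 =
  normc '[h j, h' k] ^+ 2 / ('C(n, j)%:R * 'C(n, k)%:R).
Proof.
have -> : (normalized h *m (normalized h')^t*) j k =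
    '[row j (normalized h), row k (normalized h')].
  by rewrite dotmxE !mxE; apply: eq_bigr => i _; rewrite !mxE.
rewrite !rowK dotmxZl dotmxZr !normcM normc_conj !normc_real ?invr_ge0 ?sqrtr_ge0 //.
rewrite !exprMn !exprVn !sqr_sqrtr ?ler0n // mulrA mulrC -invfM.
by [].
Qed.

Let N := overlap_sq e f.

Let NE (j k : 'I_n.+1) : normc ((normalized e *m (normalized f)^t*) j k) ^+ 2 =
  N j k / ('C(n, j)%:R * 'C(n, k)%:R).
Proof. exact: normalized_overlap. Qed.

Let N_row j k : (k <= n)%N -> N j k = N 0 k * (krawtchouk R n k)`_j ^+ 2.
Proof.
move=> kn; have [fB _ _ _ _] := fL.
rewrite /N /overlap_sq (ladder_overlap_rec j kn (fB k)) normcM exprMn; congr (_ * _).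
rewrite -(map_krawtchouk (real_complex R)) coef_map normc_sqr conjc_real.
by rewrite -rmorphM.
Qed.

(** The mirror image of [N_row]; [overlap_col] provides it by exchanging the two ladders. *)
Hypothesis N_col : forall j k, (j <= n)%N ->
  N j k = N j 0 * (krawtchouk R n j)`_k ^+ 2.

Let N0k k : N 0 k = N 0 0 * 'C(n, k)%:R ^+ 2.
Proof. by rewrite N_col // krawtchouk_0. Qed.

Let Nj0 j : N j 0 = N 0 0 * 'C(n, j)%:R ^+ 2.
Proof. by rewrite N_row // krawtchouk_0. Qed.

Let N00 : N 0 0 * 2 ^+ n = 1.
Proof.
have Uu : normalized e *m (normalized f)^t* \is unitarymx.
  apply: mul_unitarymx; first exact: normalized_unitary eL.
  by rewrite trmxC_unitary; exact: normalized_unitary fL.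
rewrite -[RHS](sum_normc_unit ord0 Uu).
have Ek (k : 'I_n.+1) : normc ((normalized e *m (normalized f)^t*) ord0 k) ^+ 2 =
    N 0 0 * 'C(n, k)%:R.
  have ck : 'C(n, k)%:R != 0 :> R by rewrite pnatr_eq0 -lt0n bin_gt0 -ltnS.
  rewrite NE; have -> : 'C(n, (ord0 : 'I_n.+1)) = 1%N by exact: bin0.
  have -> : N (ord0 : 'I_n.+1) k = N 0 0 * 'C(n, k)%:R ^+ 2 by exact: N0k.
  exact: overlap_sq_quotient.
rewrite (eq_bigr _ (fun k _ => Ek k)) -mulr_sumr; congr (_ * _).
rewrite (_ : (2 : R) = 1 + 1) // exprDn; apply: eq_bigr => k _.
by rewrite !expr1n mul1r.
Qed.

(** With p the polynomial of parameter k, the squared overlap is 2^-n C(n,k) p_j^2 / C(n,j), and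
    likewise with j and k exchanged. The form is chosen in which the coefficient index is the one
    farther from n/2. *)
Lemma overlap_bound (j k : 'I_n.+1) : (0 < n)%N ->
  normc ((normalized e *m (normalized f)^t*) j k) ^+ 2 <=
  krawtchouk_const R / Num.sqrt n%:R.
Proof.
move=> n0; have jn : (j <= n)%N by rewrite -ltnS.
have kn : (k <= n)%N by rewrite -ltnS.
rewrite NE.
have p2 : 0 < (2 ^+ n : R) by rewrite exprn_gt0.
have cj : 0 < 'C(n, j)%:R :> R by rewrite ltr0n bin_gt0.
have ck : 0 < 'C(n, k)%:R :> R by rewrite ltr0n bin_gt0.
have N0E : N 0 0 = (2 ^+ n)^-1.
  by apply: (mulIf (lt0r_neq0 p2)); rewrite N00 mulVf ?gt_eqF.
have [kj|/ltW jk] := leP `|1 - 2 * (k%:R / n%:R) : R| `|1 - 2 * (j%:R / n%:R) : R|.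
  have := krawtchouk_bound n0 jn kn kj.
  rewrite N_row // N0k N0E => h.
  rewrite ler_pdivrMr ?mulr_gt0 // -(ler_pM2l p2).
  apply: le_trans (_ : 'C(n, k)%:R * ('C(n, k)%:R * (krawtchouk R n k)`_j ^+ 2) <= _).
    by rewrite !mulrA mulfV ?mul1r -?expr2 // gt_eqF.
  apply: le_trans (ler_wpM2l (ltW ck) h) _.
  rewrite le_eqVlt; apply/orP; left; apply/eqP.
  by move: (krawtchouk_const R / _) (2 ^+ n) ('C(n, j)%:R : R) => x y z; ring.
have := krawtchouk_bound n0 kn jn jk.
rewrite N_col // Nj0 N0E => h.
rewrite ler_pdivrMr ?mulr_gt0 // -(ler_pM2l p2).
apply: le_trans (_ : 'C(n, j)%:R * ('C(n, j)%:R * (krawtchouk R n j)`_k ^+ 2) <= _).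
  by rewrite !mulrA mulfV ?mul1r -?expr2 // gt_eqF.
apply: le_trans (ler_wpM2l (ltW cj) h) _.
rewrite le_eqVlt; apply/orP; left; apply/eqP.
by move: (krawtchouk_const R / _) (2 ^+ n) ('C(n, k)%:R : R) => x y z; ring.
Qed.

(** The second moment of 2B in the top vector of A is the squared norm of 2 e_0 B = e_1, which is
    C(n,1). This moment is what [entropy_of_variance] takes in. *)
Lemma ladder_moment (F : 'M[C]_n.+1) : F \is unitarymx ->
    (forall k : 'I_n.+1, row k F *m B = (n%:R / 2 - k%:R)%:C *: row k F) ->
  \sum_(k < n.+1) (n%:R - 2 * k%:R) ^+ 2 * normc ((normalized e *m F^t*) 0 k) ^+ 2 = n%:R.
Proof.
move=> Fu FB; have [_ e1 _ en _] := eL.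
apply: complexI; transitivity '[e 1%N]; last by rewrite en bin1 rmorph_nat.
rewrite -e1.
rewrite -(@dotmx_unitary _ _ _ (F^t*)) ?trmxC_unitary // dotmx_sum rmorph_sum.
apply: eq_bigr => k _.
have -> : (2 *: (e 0%N *m B) *m F^t*) 0 k = '[2 *: (e 0%N *m B), row k F].
  by rewrite dotmxE !mxE; apply: eq_bigr => i _; rewrite !mxE.
have -> : (normalized e *m F^t*) 0 k = '[e 0%N, row k F].
  have -> : (normalized e *m F^t*) 0 k = '[row 0 (normalized e), row k F].
    by rewrite dotmxE !mxE; apply: eq_bigr => i _; rewrite !mxE.
  by rewrite rowK bin0 sqrtr1 invr1 scale1r.
rewrite dotmxZl dotmxMl Bh FB dotmxZr mulrA normrM exprMn rmorphM; congr (_ * _).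
  apply: etrans (esym (sqr_norm_real _)) _; congr (`|_| ^+ 2); apply: esym.
  transitivity (2 * (n%:R / 2 - k%:R)%:C : C).
    by congr (_ * _); exact: conjc_real.
  rewrite -(rmorph_nat (real_complex R) 2) -rmorphM; congr _%:C.
  by field.
by rewrite normcE_norm -rmorphXn.
Qed.

End Overlaps.

Lemma overlap_col n (A B : 'M[C]_n.+1) (e f : nat -> 'rV[C]_n.+1) j k :
    A^t* = A -> ladder A B e -> ladder B A f -> (j <= n)%N ->
  overlap_sq e f j k = overlap_sq e f j 0 * (krawtchouk R n j)`_k ^+ 2.
Proof.
move=> Ah eL fL jn; have sym i l : overlap_sq e f i l = overlap_sq f e l i.
  by rewrite /overlap_sq dotmx_conj normc_conj.
have [eA _ _ _ _] := eL; rewrite !sym /overlap_sq.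
rewrite (ladder_overlap_rec Ah fL k jn (eA j)) normcM exprMn; congr (_ * _).
rewrite -(map_krawtchouk (real_complex R)) coef_map normc_sqr conjc_real.
by rewrite -rmorphM.
Qed.

Lemma spin_bases n (L1 L2 L3 : 'M[C]_n.+1) : (0 < n)%N -> spin_rep L1 L2 L3 ->
  exists E F : 'M[C]_n.+1,
  [/\ E \is unitarymx /\ F \is unitarymx,
      forall j : 'I_n.+1, row j E *m L1 = (n%:R / 2 - j%:R)%:C *: row j E,
      forall k : 'I_n.+1, row k F *m L2 = (n%:R / 2 - k%:R)%:C *: row k F,
      forall j k, normc ((E *m F^t*) j k) ^+ 2 <= krawtchouk_const R / Num.sqrt n%:R &
      \sum_(k < n.+1) (n%:R - 2 * k%:R) ^+ 2 * normc ((E *m F^t*) 0 k) ^+ 2 = n%:R /\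
      \sum_(k < n.+1) (n%:R - 2 * k%:R) ^+ 2 * normc ((F *m E^t*) 0 k) ^+ 2 = n%:R].
Proof.
move=> n0 L; have [e eL] := spin_ladder L; have [f fL] := spin_ladder (spin_rep_swap L).
have [[h1 h2 _] _] := L.
have L1h := hermsymmxP h1; have L2h := hermsymmxP h2.
have Eu := normalized_unitary eL; have Fu := normalized_unitary fL.
have rowE (A B : 'M[C]_n.+1) h (j : 'I_n.+1) : ladder A B h ->
    row j (normalized h) *m A = (n%:R / 2 - j%:R)%:C *: row j (normalized h).
  by move=> [hA _ _ _ _]; rewrite rowK -scalemxAl hA !scalerA mulrC.
exists (normalized e), (normalized f); split=> //.
- by move=> j; exact: rowE eL.
- by move=> j; exact: rowE fL.
- move=> j k; apply: (overlap_bound L2h eL fL) => // i l.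
  exact: overlap_col L1h eL fL.
split.
  by apply: (ladder_moment L2h eL Fu) => k; exact: rowE fL.
by apply: (ladder_moment L1h fL Eu) => k; exact: rowE eL.
Qed.

End SpinBases.

(** * Entropy bounds and the limit *)

Section EntropyBounds.
Variable R : realType.
Implicit Types (u v x : R).

Lemma neg_xlnx_le1 x : 0 <= x -> - (x * ln x) <= 1.
Proof.
rewrite le_eqVlt => /orP[/eqP <-|x0]; first by rewrite mul0r oppr0.
have h : ln x^-1 <= x^-1 - 1.
  have -> : x^-1 = 1 + (x^-1 - 1) by ring.
  by apply: le_trans (le_ln1Dx _) _; [have : 0 < x^-1 by rewrite invr_gt0|]; lra.
rewrite lnV ?posrE // in h.
have := ler_wpM2l (ltW x0) h; rewrite mulrN mulrBr mulfV ?gt_eqF // mulr1; lra.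
Qed.

Lemma neg_xlnx_subadd u v : 0 <= u -> 0 <= v ->
  - ((u + v) * ln (u + v)) <= - (u * ln u) - v * ln v.
Proof.
move=> u0 v0; have mono (a b : R) : 0 <= a -> 0 <= b -> a * ln a <= a * ln (a + b).
  rewrite le_eqVlt => /orP[/eqP <-|a0] b0; first by rewrite !mul0r.
  by rewrite ler_pM2l // ler_ln ?posrE; lra.
have h1 := mono u v u0 v0; have h2 := mono v u v0 u0.
by rewrite addrC in h2; rewrite mulrDl; lra.
Qed.

(* Gibbs' inequality against the heavy-tailed weights 1 / (n + (n - 2k)^2). *)
Lemma entropy_of_variance n (q : 'I_n.+1 -> R) : (0 < n)%N ->
    (forall k, 0 <= q k) -> \sum_k q k = 1 ->
    \sum_(k < n.+1) (n%:R - 2 * k%:R) ^+ 2 * q k = n%:R ->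
  - \sum_k q k * ln (q k) <= 2^-1 * ln n%:R + 16.
Proof.
move=> n0 q0 q1 qv; have nR : 0 < n%:R :> R by rewrite ltr0n.
pose s : R := Num.sqrt n%:R; have s0 : 0 < s by rewrite sqrtr_gt0.
have ss : s ^+ 2 = n%:R by rewrite sqr_sqrtr // ltW.
have s1 : 1 <= s by rewrite -[leLHS]sqrtr1 ler_sqrt ?ler1n.
pose d (k : 'I_n.+1) : R := n%:R + (n%:R - 2 * k%:R) ^+ 2.
have d0 k : 0 < d k by rewrite ltr_pwDl ?sqr_ge0.
pose Z := \sum_k (d k)^-1.
have Z0 : 0 < Z.
  rewrite /Z (bigD1 ord0) //= ltr_pwDl ?invr_gt0 // sumr_ge0 // => i _.
  by rewrite invr_ge0 ltW.
have ZU : Z <= 8 / s.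
  (* The distance from k to the rounded midpoint never exceeds |n - 2k|, for either parity of n. *)
  pose i0 := (n./2)%N.
  have i0n : (i0 < n.+1)%N by rewrite /i0; lia.
  pose F (m : nat) := (s ^+ 2 + m%:R ^+ 2)^-1.
  have F0 m : 0 <= F m by rewrite invr_ge0 addr_ge0 ?sqr_ge0.
  apply: le_trans (_ : \sum_(k < n.+1) F (k - i0 + (i0 - k))%N <= _).
    apply: ler_sum => k _; rewrite /F /d ss.
    rewrite lef_pV2 ?posrE ?ltr_pwDl ?sqr_ge0 // lerD2l.
    set m := (_ + _)%N.
    have [kn|nk] := leqP (2 * k) n.
      have -> : (n%:R - 2 * k%:R : R) = (n - 2 * k)%:R by rewrite natrB // natrM.
      by rewrite ler_sqr ?nnegrE // ler_nat /m /i0; lia.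
    have -> : (n%:R - 2 * k%:R : R) = - (2 * k - n)%:R.
      by rewrite natrB ?(ltnW nk) // natrM opprB.
    by rewrite sqrrN ler_sqr ?nnegrE // ler_nat /m /i0; lia.
  apply: le_trans (sum_dist_le F0 i0n) _.
  have := sum_inv_sqr_le n.+1 s1; rewrite -/F => h.
  have -> : 8 / s = 2 * (4 / s) by field; rewrite gt_eqF.
  by rewrite ler_pM2l.
have gibbs k : - (q k * ln (q k)) <=
    (d k)^-1 / Z - q k + q k * ln Z + q k * ln (d k).
  have [->|qk] := eqVneq (q k) 0.
    by rewrite !mul0r oppr0 !addr0; apply: divr_ge0; rewrite ?invr_ge0; exact: ltW.
  have qk0 : 0 < q k by rewrite lt_def qk q0.
  have w0 : 0 < (d k)^-1 / Z / q k by rewrite !divr_gt0 ?invr_gt0.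
  have h : ln ((d k)^-1 / Z / q k) <= (d k)^-1 / Z / q k - 1.
    have -> : (d k)^-1 / Z / q k = 1 + ((d k)^-1 / Z / q k - 1) by ring.
    by apply: le_trans (le_ln1Dx _) _; move: w0; move: (_ / q k) => w; lra.
  rewrite !ln_div ?lnV ?posrE ?divr_gt0 ?invr_gt0 // in h.
  have := ler_wpM2l (ltW qk0) h.
  have -> : q k * ((d k)^-1 / Z / q k - 1) = (d k)^-1 / Z - q k.
    by field; rewrite qk !gt_eqF.
  by move: ((d k)^-1 / Z) (ln (d k)) (ln Z) (ln (q k)) => *; lra.
(* The tangent to ln at 2n, the mean of [d] under [q]; its linear part therefore averages to
   zero. *)
have dlog k : q k * ln (d k) <= q k * (ln (2 * n%:R) + (d k / (2 * n%:R) - 1)).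
  apply: ler_wpM2l; first exact: q0.
  have n2 : 0 < 2 * n%:R :> R by rewrite mulr_gt0.
  have -> : d k = (2 * n%:R) * (1 + (d k / (2 * n%:R) - 1)) by field; rewrite gt_eqF.
  have e0 : 0 < 1 + (d k / (2 * n%:R) - 1) by rewrite addrC subrK divr_gt0.
  rewrite lnM ?posrE // lerD2l.
  have e1 : 2 * n%:R * (1 + (d k / (2 * n%:R) - 1)) / (2 * n%:R) - 1 = d k / (2 * n%:R) - 1.
    by field; rewrite gt_eqF.
  by rewrite e1; apply: le_ln1Dx; lra.
rewrite -sumrN.
apply: le_trans (ler_sum _ (fun k _ => le_trans (gibbs k) (lerD (lexx _) (dlog k)))) _.
have -> : \sum_k ((d k)^-1 / Z - q k + q k * ln Z +
    q k * (ln (2 * n%:R) + (d k / (2 * n%:R) - 1))) = ln Z + ln (2 * n%:R).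
  rewrite !big_split /= -mulr_suml -/Z mulfV ?gt_eqF // sumrN -mulr_suml q1 subrr add0r mul1r.
  congr (_ + _).
  transitivity (\sum_k (q k * (ln (2 * n%:R) - 1 + 2^-1) +
      (n%:R - 2 * k%:R) ^+ 2 * q k * (2 * n%:R)^-1)).
    apply: eq_bigr => k _; rewrite /d; move: ((_ - _) ^+ 2) (ln _) => x y.
    by field; rewrite gt_eqF.
  rewrite big_split /= -!mulr_suml q1 qv; field; rewrite gt_eqF //.
have lnZ : ln Z <= ln (8 / s) by rewrite ler_ln ?posrE ?divr_gt0.
have lns : ln s = 2^-1 * ln n%:R by rewrite -ss lnXn // -mulr_natl; field.
rewrite ln_div ?posrE // lns in lnZ; rewrite lnM ?posrE //.
have l8 : ln 8 <= 7 :> R by have := @le_ln1Dx R 7; rewrite (_ : 1 + 7 = 8 :> R); [apply; lra|ring].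
have l2 : ln 2 <= 1 :> R by have := @le_ln1Dx R 1; rewrite (_ : 1 + 1 = 2 :> R) //; apply; lra.
lra.
Qed.

(** 18 is the 16 of [entropy_of_variance] plus at most 1 for each of -a ln a and -b ln b. *)
Lemma mixture_entropy n (a b : R) (q : 'I_n.+1 -> R) : (0 < n)%N ->
    0 <= a -> 0 <= b -> b <= 1 ->
    (forall k, 0 <= q k) -> \sum_k q k = 1 ->
    \sum_(k < n.+1) (n%:R - 2 * k%:R) ^+ 2 * q k = n%:R ->
  - \sum_k (a * (k == ord0)%:R + b * q k) * ln (a * (k == ord0)%:R + b * q k)
  <= b * (2^-1 * ln n%:R) + 18.
Proof.
move=> n0 a0 b0 b1 q0 q1 qv.
have H := entropy_of_variance n0 q0 q1 qv.
rewrite -sumrN.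
apply: le_trans (_ : \sum_k (- (a * (k == ord0)%:R * ln (a * (k == ord0)%:R))
    + (q k * - (b * ln b) + b * - (q k * ln (q k)))) <= _).
  apply: ler_sum => k _; apply: le_trans (neg_xlnx_subadd _ _) _; rewrite ?mulr_ge0 //.
  rewrite lerD2l.
  have [->|bn] := eqVneq b 0; first by rewrite !mul0r oppr0 mulr0 addr0.
  have [->|qn] := eqVneq (q k) 0; first by rewrite !(mulr0, mul0r) oppr0 mulr0 addr0.
  rewrite lnM ?posrE ?lt_def ?bn ?qn ?b0 ?q0 // le_eqVlt; apply/orP; left; apply/eqP.
  by move: (ln _) (ln _) => *; ring.
rewrite !big_split /= -mulr_suml -mulr_sumr q1 mul1r.
rewrite (bigD1 ord0) //= big1 => [|k k0]; last by rewrite (negPf k0) mulr0 mul0r oppr0.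
rewrite ?eqxx mulr1 addr0 sumrN.
have ha := neg_xlnx_le1 a0; have hb := neg_xlnx_le1 b0.
have := ler_wpM2l b0 H; nra.
Qed.

End EntropyBounds.

(** * From an explicit eigenbasis to [spectralmx] *)

Section SpectralBasis.
Local Open Scope sesquilinear_scope.
Local Open Scope complex_scope.
Variable R : realType.
Local Notation C := R[i].
Local Notation normc := ComplexField.Normc.normc.
Local Notation "''[' u , v ]" := (dotmx u v) : ring_scope.
Local Notation "''[' u ]" := '[u, u]%R : ring_scope.

(** Eigenvectors for different eigenvalues are orthogonal, so a simple spectrum leaves one nonzero
    entry, of modulus 1, in each row of the transition matrix. The choice made by [spectralmx] thus
    amounts to a permutation and phases. *)
Lemma spectral_rows d (A E : 'M[C]_d) (lam : 'I_d -> C) :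
    A \is hermsymmx -> E \is unitarymx -> injective lam ->
    (forall j, lam j \is Num.real) ->
    (forall j, row j E *m A = lam j *: row j E) ->
  exists (s : 'I_d -> 'I_d) (c : 'I_d -> C), injective s /\
    forall i, `|c i| = 1 /\ row i (spectralmx A) = c i *: row (s i) E.
Proof.
move=> Ah Eu lamI lamR EA; set S := spectralmx A.
have Su : S \is unitarymx := spectral_unitarymx A.
pose T := S *m E^t*.
have TE i j : T i j = '[row i S, row j E].
  by rewrite dotmxE !mxE; apply: eq_bigr => k _; rewrite !mxE.
have T0 i j : spectral_diag A 0 i != lam j -> T i j = 0.
  move=> ij; rewrite TE.
  exact: (herm_eigenvec_ortho (hermsymmxP Ah) (spectral_row i Ah) (EA j) (lamR j) ij).
have ST i : row i S = row i T *m E.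
  by rewrite -row_mul /T (mulmxKtV _ Eu erefl).
have ex i : exists j, spectral_diag A 0 i = lam j.
  have [//|no] := pselect (exists j, spectral_diag A 0 i = lam j).
  have r0 : row i T = 0.
    apply/rowP => j; rewrite !mxE -[LHS](_ : T i j = _); last by rewrite mxE.
    by apply: T0; apply/eqP => h; apply: no; exists j.
  have := row_unitary i Su; rewrite ST r0 mul0mx dotmxE mul0mx mxE => /esym/eqP.
  by rewrite oner_eq0.
have [s sP] := choice ex.
have rowS i : row i S = T i (s i) *: row (s i) E.
  have -> : row i S = \sum_j T i j *: row j E.
    rewrite ST mulmx_sum_row; apply: eq_bigr => j _; congr (_ *: _).
    by rewrite [LHS]mxE.
  rewrite (bigD1 (s i)) //= big1 ?addr0 // => j ji.
  rewrite T0 ?scale0r // sP; apply: contra ji => /eqP/lamI -> //.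
have cn i : `|T i (s i)| ^+ 2 = 1.
  by have := row_unitary i Su; rewrite rowS dotmxZ (row_unitary _ Eu) mulr1.
exists s, (fun i => T i (s i)); split.
  move=> i j sij; apply/eqP/negP => /negP ij.
  have /row_unitarymxP/(_ i j) := Su; rewrite (negPf ij) rowS (rowS j) sij.
  rewrite dotmxZl dotmxZr (row_unitary _ Eu) mulr1 => /eqP.
  rewrite mulf_eq0 conjC_eq0 => /orP[/eqP h|/eqP h].
    by have /eqP := cn i; rewrite sij h normr0 expr0n eq_sym oner_eq0.
  by have /eqP := cn j; rewrite h normr0 expr0n eq_sym oner_eq0.
move=> i; split; last exact: rowS.
by apply/eqP; rewrite -sqrp_eq1 // cn.
Qed.

Definition basis_prob d (E rho : 'M[C]_d) (j : 'I_d) : R :=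
  complex.Re ((row j E *m rho *m (row j E)^t*) 0 0).

Lemma entropy_basis d (A E rho : 'M[C]_d) (lam : 'I_d -> C) :
    A \is hermsymmx -> E \is unitarymx -> injective lam ->
    (forall j, lam j \is Num.real) ->
    (forall j, row j E *m A = lam j *: row j E) ->
  entropy A rho =
  - (\sum_j basis_prob E rho j * ln (basis_prob E rho j)) / ln d%:R.
Proof.
move=> Ah Eu lamI lamR EA; have [s [c [sI rowS]]] := spectral_rows Ah Eu lamI lamR EA.
rewrite entropyE; congr (- _ / _); rewrite [RHS](reindex_inj sI) /=.
suff pE i : outcome_prob A rho i = basis_prob E rho (s i).
  by apply: eq_bigr => i _; rewrite pE.
have [ci ri] := rowS i; rewrite outcome_probE /basis_prob.
have -> : (spectralmx A *m rho *m (spectralmx A)^t*) i i =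
    (row i (spectralmx A) *m rho *m (row i (spectralmx A))^t*) 0 0.
  by rewrite -row_mul [RHS]mxE mxE; apply: eq_bigr => k _; rewrite !mxE.
rewrite ri linearZ /= map_mxZ -!scalemxAl -scalemxAr scalerA.
have -> : c i * (c i)^*%R = 1 by rewrite -normCK ci expr1n.
by rewrite scale1r.
Qed.

Lemma max_overlap_basis d (A B E F : 'M[C]_d) (lam mu : 'I_d -> C) (K : R) :
    A \is hermsymmx -> E \is unitarymx -> injective lam ->
    (forall j, lam j \is Num.real) ->
    (forall j, row j E *m A = lam j *: row j E) ->
    B \is hermsymmx -> F \is unitarymx -> injective mu ->
    (forall j, mu j \is Num.real) ->
    (forall j, row j F *m B = mu j *: row j F) ->
    0 <= K -> (forall j k, normc ((E *m F^t*) j k) ^+ 2 <= K) ->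
  max_overlap A B <= Num.sqrt K.
Proof.
move=> Ah Eu lamI lamR EA Bh Fu muI muR FB K0 EF.
have [s [c [_ rowA]]] := spectral_rows Ah Eu lamI lamR EA.
have [t [b [_ rowB]]] := spectral_rows Bh Fu muI muR FB.
apply: bigmax_le => [|i _]; first exact: sqrtr_ge0.
apply: bigmax_le => [|j _]; first exact: sqrtr_ge0.
have [ci ri] := rowA i; have [bj rj] := rowB j.
rewrite overlapE.
have -> : (spectralmx A *m (spectralmx B)^t*) i j =
    '[row i (spectralmx A), row j (spectralmx B)].
  by rewrite dotmxE !mxE; apply: eq_bigr => k _; rewrite !mxE.
have -> : normc '[row i (spectralmx A), row j (spectralmx B)] =
    normc ((E *m F^t*) (s i) (t j)).
  have -> : (E *m F^t*) (s i) (t j) = '[row (s i) E, row (t j) F].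
    by rewrite dotmxE !mxE; apply: eq_bigr => k _; rewrite !mxE.
  apply: complexI; rewrite -!normcE_norm ri rj dotmxZl dotmxZr !normrM ci.
  by rewrite norm_conjC bj mul1r mul1r.
by rewrite -[leLHS]ger0_norm ?normc_ge0 // -sqrtr_sqr ler_sqrt.
Qed.

Definition mixture n (a b : R) (v w : 'rV[C]_n) : 'M[C]_n :=
  a%:C *: (v^t* *m v) + b%:C *: (w^t* *m w).

Lemma mixture_form n (a b : R) (v w u : 'rV[C]_n) :
  (u *m mixture a b v w *m u^t*) 0 0 =
  (a * normc '[v, u] ^+ 2 + b * normc '[w, u] ^+ 2)%:C.
Proof.
have one (x : 'rV[C]_n) : (u *m (x^t* *m x) *m u^t*) 0 0 = (normc '[x, u] ^+ 2)%:C.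
  have -> : (u *m (x^t* *m x) *m u^t*) 0 0 = '[u, x] * '[x, u].
    by rewrite !mulmxA -(mulmxA (u *m x^t*)) mxE big_ord1 !dotmxE.
  by rewrite dotmx_conj normc_sqr mulrC -sqr_normc normcE_norm -rmorphXn.
rewrite /mixture mulmxDr mulmxDl mxE -!scalemxAr -!scalemxAl.
rewrite [X in X + _]mxE [X in _ + X]mxE (one v) (one w).
by rewrite rmorphD; congr (_ + _); exact: esym (rmorphM (real_complex R) _ _).
Qed.

Lemma mixture_density n (a b : R) (v w : 'rV[C]_n) :
  0 <= a -> 0 <= b -> a + b = 1 -> '[v] = 1 -> '[w] = 1 ->
  density (mixture a b v w).
Proof.
move=> a0 b0 ab v1 w1; split.
- apply: hermsymmx_intro; rewrite /mixture linearD map_mxD !linearZ /= !map_mxZ.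
  rewrite !trmxC_mul !trmxCK.
  by congr (_ *: _ + _ *: _); exact: conjc_real.
- move=> x; have := mixture_form a b v w (x^t*); rewrite trmxCK => ->.
  by rewrite ler0c addr_ge0 // mulr_ge0 // sqr_ge0.
have tr1 (x : 'rV[C]_n) : \tr (x^t* *m x) = '[x].
  by rewrite mxtrace_mulC trace_mx11 dotmxE.
by rewrite /mixture linearD !linearZ /= !tr1 v1 w1 !mulr1 -rmorphD ab.
Qed.

End SpectralBasis.

(** * Estimates at finite spin *)

Section SpinBounds.
Local Open Scope sesquilinear_scope.
Local Open Scope complex_scope.
Variable R : realType.
Local Notation C := R[i].
Local Notation normc := ComplexField.Normc.normc.
Local Notation "''[' u , v ]" := (dotmx u v) : ring_scope.
Local Notation "''[' u ]" := '[u, u]%R : ring_scope.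

Lemma mixture_basis_prob n (E F : 'M[C]_n.+1) (a b : R) j : E \is unitarymx ->
  basis_prob E (mixture a b (row 0 E) (row 0 F)) j =
  a * (j == ord0)%:R + b * normc ((F *m E^t*) 0 j) ^+ 2.
Proof.
move=> Eu; rewrite /basis_prob mixture_form /=; congr (_ * _ + _ * _).
  have /row_unitarymxP -> := Eu; rewrite normc_natr eq_sym.
  by case: eqP => _; rewrite ?expr1n ?expr0n.
congr (normc _ ^+ 2).
by rewrite dotmxE !mxE; apply: eq_bigr => k _; rewrite !mxE.
Qed.

Lemma mixtureC n (a b : R) (v w : 'rV[C]_n) : mixture a b v w = mixture b a w v.
Proof. by rewrite /mixture addrC. Qed.

Lemma ln_succ_le n : (0 < n)%N -> ln n.+1%:R <= ln n%:R + 1 :> R.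
Proof.
move=> n0; have nR : 0 < n%:R :> R by rewrite ltr0n.
have n1 : 1 <= n%:R :> R by rewrite ler1n.
have -> : n.+1%:R = n%:R * (1 + n%:R^-1) :> R.
  by rewrite -natr1 mulrDr mulr1 mulfV ?gt_eqF.
have i0 : 0 < n%:R^-1 :> R by rewrite invr_gt0.
have i1 : n%:R^-1 <= 1 :> R by rewrite invf_le1.
rewrite lnM ?posrE ?addr_gt0 //.
by rewrite lerD2l; apply: le_trans (le_ln1Dx _) i1; lra.
Qed.

(** 18 is the entropy constant of [mixture_entropy], the logarithm that of the overlap bound; their
    sum serves both estimates. *)
Definition error_const : R := 18 + ln (krawtchouk_const R).

Lemma krawtchouk_const_ge1 : 1 <= krawtchouk_const R.
Proof.
have h := expR_ge1Dx (5 / 2 : R).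
by rewrite /krawtchouk_const expr_ge1 //; lra.
Qed.

Lemma spin_finite_bounds n (L1 L2 L3 : 'M[C]_n.+1) (l := ln n.+1%:R) :
    (0 < n)%N -> spin_rep L1 L2 L3 ->
  2^-1 - error_const / l <= maassen_uffink L1 L2 /\
  forall a b : R, 0 <= a -> 0 <= b -> a + b = 1 ->
    exists rho : 'M[C]_n.+1, [/\ density rho,
      entropy L1 rho <= b / 2 + error_const / l &
      entropy L2 rho <= a / 2 + error_const / l].
Proof.
move=> n0 L; have [E [F [[Eu Fu] EL FL bound [m1 m2]]]] := spin_bases n0 L.
have [[h1 h2 _] _] := L.
have nR : 0 < n%:R :> R by rewrite ltr0n.
have l0 : 0 < l by rewrite ln_gt0 // ltr1n.
have lnl : ln n%:R <= l by rewrite ler_ln ?posrE ?ltr0n // ler_nat.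
have ll : l <= ln n%:R + 1 by exact: ln_succ_le.
have K1 := krawtchouk_const_ge1.
have lK : 0 <= ln (krawtchouk_const R) by rewrite ln_ge0.
pose lam (j : 'I_n.+1) : C := (n%:R / 2 - j%:R)%:C.
have lamI : injective lam.
  move=> i j /complexI h; apply/val_inj/eqP; rewrite /= -(eqr_nat R); apply/eqP; lra.
have lamR j : lam j \is Num.real by rewrite complex_real.
have s0 : 0 < Num.sqrt n%:R :> R by rewrite sqrtr_gt0.
split.
  pose K := krawtchouk_const R / Num.sqrt n%:R.
  have K0 : 0 < K by rewrite divr_gt0 //; lra.
  have c0 := max_overlap_gt0 L1 L2.
  have cK : max_overlap L1 L2 ^+ 2 <= K.
    rewrite -(sqr_sqrtr (ltW K0)) ler_sqr ?nnegrE ?sqrtr_ge0 ?(ltW c0) //.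
    exact: (max_overlap_basis h1 Eu lamI lamR EL h2 Fu lamI lamR FL (ltW K0) bound).
  have lnc : ln (max_overlap L1 L2 ^+ 2) <= ln (krawtchouk_const R) - 2^-1 * ln n%:R.
    apply: le_trans (_ : ln K <= _); first by rewrite ler_ln ?posrE ?exprn_gt0.
    have -> : ln n%:R = 2 * ln (Num.sqrt n%:R) :> R.
      by rewrite -[in LHS](sqr_sqrtr (ltW nR)) lnXn // mulr_natl.
    by rewrite /K ln_div ?posrE //; lra.
  have -> : 2^-1 - error_const / l = (2^-1 * l - error_const) / l.
    by field; rewrite gt_eqF.
  rewrite /maassen_uffink /log_base -/l -mulNr.
  rewrite ler_pM2r ?invr_gt0 // /error_const; lra.
move=> a b a0 b0 ab.
have tail (x t : R) : 0 <= x -> x <= 1 -> t <= x * (2^-1 * ln n%:R) + 18 ->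
    t / l <= x / 2 + error_const / l.
  move=> x0 x1 ht; have -> : x / 2 + error_const / l = (x / 2 * l + error_const) / l.
    by field; rewrite gt_eqF.
  rewrite ler_pM2r ?invr_gt0 // /error_const.
  have := ler_wpM2l x0 lnl; lra.
(* The observable diagonal in [G] sees a point mass of weight x and a spread law of weight y, so
   only y enters the leading term. Exchanging the bases treats the other observable. *)
have half (G H : 'M[C]_n.+1) (A : 'M[C]_n.+1) (x y : R) :
    A \is hermsymmx -> G \is unitarymx -> H \is unitarymx ->
    (forall j : 'I_n.+1, row j G *m A = lam j *: row j G) ->
    \sum_(k < n.+1) (n%:R - 2 * k%:R) ^+ 2 * normc ((H *m G^t*) 0 k) ^+ 2 = n%:R ->
    0 <= x -> 0 <= y -> x + y = 1 ->
    entropy A (mixture x y (row 0 G) (row 0 H)) <= y / 2 + error_const / l.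
  move=> Ah Gu Hu GA mom x0 y0 xy.
  rewrite (entropy_basis _ Ah Gu lamI lamR GA); apply: tail => //; first by lra.
  under eq_bigr do rewrite mixture_basis_prob //.
  apply: mixture_entropy => //; first by lra.
    by move=> k; exact: sqr_ge0.
  have HGu : H *m G^t* \is unitarymx.
    by apply: mul_unitarymx; rewrite ?trmxC_unitary; [exact: Hu|exact: Gu].
  exact: sum_normc_unit HGu.
exists (mixture a b (row 0 E) (row 0 F)); split.
- exact: (mixture_density a0 b0 ab (row_unitary 0 Eu) (row_unitary 0 Fu)).
- exact: (half E F L1 a b h1 Eu Fu EL m2 a0 b0 ab).
- rewrite mixtureC; apply: (half F E L2 b a h2 Fu Eu FL m1 b0 a0).
  by rewrite addrC.
Qed.

End SpinBounds.

(** * The limit *)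

Lemma cvg_of_log_error (R : realType) (f : nat -> R) (x K : R) :
    (forall n, (0 < n)%N -> `|f n - x| <= K / ln n.+1%:R) ->
  f @ \oo --> x.
Proof.
move=> fx; apply/cvgrPdist_lt => e e0.
pose N := Num.bound (expR (`|K| / e)).
exists N.+1 => // n /= Nn; have n0 : (0 < n)%N by exact: leq_trans Nn.
rewrite distrC; apply: le_lt_trans (fx n n0) _.
have lnn : `|K| / e < ln n.+1%:R.
  rewrite -ltr_expR lnK ?posrE ?ltr0n //.
  apply: lt_le_trans (_ : N%:R <= _); first by rewrite archi_boundP ?expR_ge0.
  by rewrite ler_nat ltnW // ltnS ltnW.
have ln0 : 0 < ln n.+1%:R :> R by rewrite ln_gt0 // ltr1n.
rewrite ltr_pdivrMr // mulrC -ltr_pdivrMr //; apply: le_lt_trans lnn.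
by rewrite ler_pM2r ?invr_gt0 // ler_norm.
Qed.

(* The index n is 2s, so the spin s representation acts on C^(n+1). *)
Theorem proposition8 (R : realType) (L1 L2 L3 : forall n : nat, 'M[R[i]]_n.+1)
    (HL : forall n : nat, (0 < n)%N -> spin_rep (L1 n) (L2 n) (L3 n)) :
  [/\ (forall (n : nat) (rho : 'M[R[i]]_n.+1), (0 < n)%N -> density rho ->
         entropy (L1 n) rho + entropy (L2 n) rho
           >= maassen_uffink (L1 n) (L2 n)),
      (fun n : nat => maassen_uffink (L1 n) (L2 n)) @ \oo --> (2^-1 : R) &
      (forall x y : R, 0 <= x -> 0 <= y -> x + y = 2^-1 ->
         exists rho : forall n : nat, 'M[R[i]]_n.+1,
           (forall n : nat, (0 < n)%N -> density (rho n)) /\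
           (fun n : nat => (entropy (L1 n) (rho n), entropy (L2 n) (rho n)))
             @ \oo --> (x, y))].
Proof.
pose K := error_const R.
have MU n (rho : 'M[R[i]]_n.+1) : (0 < n)%N -> density rho ->
    maassen_uffink (L1 n) (L2 n) <= entropy (L1 n) rho + entropy (L2 n) rho.
  by move=> n0; exact: maassen_uffink_le.
split=> //.
  apply: (@cvg_of_log_error _ _ _ (2 * K)) => n n0.
  have [lo st] := @spin_finite_bounds R n _ _ _ n0 (HL n n0).
  (* The top eigenvector of [L1] as a pure state: its entropies are at most K / l and 1/2 + K / l
     with l = ln (n + 1), and their sum bounds the constant from above. *)
  have [rho [drho H1 H2]] := st 1 0 ler01 (lexx 0) (addr0 1).
  have up := MU n rho n0 drho; rewrite -/K in lo H1 H2.
  rewrite ler_norml -mulrA; move: lo up H1 H2.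
  by move: (K / _) (maassen_uffink _ _) (entropy _ _) (entropy _ _) => *; lra.
move=> x y x0 y0 xy.
have ex n : exists rho : 'M[R[i]]_n.+1, (0 < n)%N -> [/\ density rho,
      entropy (L1 n) rho <= x + K / ln n.+1%:R &
      entropy (L2 n) rho <= y + K / ln n.+1%:R].
  (* Nothing is claimed of the state at n = 0, so any matrix fills the place. *)
  have [->|n0] := posnP n; first by exists 0.
  have [_ st] := @spin_finite_bounds R n _ _ _ n0 (HL n n0).
  have ab : 2 * y + 2 * x = 1 by lra.
  have [rho [drho H1 H2]] := st (2 * y) (2 * x) (mulr_ge0 (ler0n _ 2) y0) (mulr_ge0 (ler0n _ 2) x0) ab.
  exists rho => _; split=> //.
    by apply: le_trans H1 _; rewrite lerD2r; lra.
  by apply: le_trans H2 _; rewrite lerD2r; lra.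
pose rho n := sval (cid (ex n)); have rhoP n n0 := svalP (cid (ex n)) n0.
exists rho; split=> [n /rhoP[]//|].
(* From below, the entropy of [L1] is at least the Maassen-Uffink constant minus the entropy of
   [L2], hence at least (1/2 - K / l) - (y + K / l) = x - 2 K / l. *)
have c1 : (fun n => entropy (L1 n) (rho n)) @ \oo --> x.
  apply: (@cvg_of_log_error _ _ _ (2 * K)) => n n0.
  have [drho H1 H2] := rhoP n n0; have [lo _] := @spin_finite_bounds R n _ _ _ n0 (HL n n0).
  have up := MU n _ n0 drho; rewrite -/K in lo.
  rewrite ler_norml -mulrA; move: lo up H1 H2; rewrite -/(rho n).
  by move: (K / _) (maassen_uffink _ _) (entropy (L1 n) _) (entropy (L2 n) _) => *; lra.
have c2 : (fun n => entropy (L2 n) (rho n)) @ \oo --> y.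
  apply: (@cvg_of_log_error _ _ _ (2 * K)) => n n0.
  have [drho H1 H2] := rhoP n n0; have [lo _] := @spin_finite_bounds R n _ _ _ n0 (HL n n0).
  have up := MU n _ n0 drho; rewrite -/K in lo.
  rewrite ler_norml -mulrA; move: lo up H1 H2; rewrite -/(rho n).
  by move: (K / _) (maassen_uffink _ _) (entropy (L1 n) _) (entropy (L2 n) _) => *; lra.
exact: (cvg_pair c1 c2).
Qed.
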